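(* Let $\zeta>0$. Consider $w_r(\cdot,\zeta)$ as a function of $\xi$ alone and $v(\cdot,\zeta)$ as a distribution in $\xi$ alone. Then $$\lim_{r\to\infty} w_r(\cdot,\zeta) = v(\cdot,\zeta)\qquad\text{in } \mathcal S'(\mathbb R).$$ If $v(\cdot,\zeta)$ is considered as a $1$-periodic distribution, then for any $s>1/2$, $$\lim_{r\to\infty} w_r(\cdot,\zeta) = v(\cdot,\zeta)\qquad\text{in } H^{-s}(\mathbb T).$$ In both cases, if $\zeta<0$, then $w_r(\cdot,\zeta)=w_r(\cdot,|\zeta|)$, so that $\lim_{r\to\infty} w_r(\cdot,\zeta)=v(\cdot,|\zeta|)$ (in $\mathcal S'(\mathbb R)$, and in $H^{-s}(\mathbb T)$ for any $s>1/2$, respectively).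
   Context: For real $r>0$, $\xi\in\mathbb R$ and $\zeta\ge 0$, set $$w_r(\xi,\zeta)=e^{-2\pi i r^2\zeta}\sum_{n\in\mathbb Z} e^{2\pi i r^2\sqrt{1-(n/r)^2}\,\zeta}\,e^{2\pi i n\xi},$$ with the convention $\sqrt{1-(n/r)^2}=i\sqrt{(n/r)^2-1}$ when $|n|>r$ (so those terms carry the decaying factor $e^{-2\pi r^2\sqrt{(n/r)^2-1}\,\zeta}$). For $\zeta<0$ set $w_r(\xi,\zeta)=w_r(\xi,|\zeta|)$. Let $$v(\xi,\zeta)=\sum_{n\in\mathbb Z}e^{2\pi i n\xi-i\pi n^2\zeta},$$ understood for fixed $\zeta$ as a distribution in $\xi$: as an element of $\mathcal S'(\mathbb R)$, $\langle v(\cdot,\zeta),\varphi\rangle=\sum_{n\in\mathbb Z}e^{-i\pi n^2\zeta}\widehat\varphi(n)$ for $\varphi\in\mathcal S(\mathbb R)$, where $\widehat\varphi(x)=\int_{\mathbb R}\varphi(\xi)e^{-2\pi i x\xi}\,d\xi$; as a $1$-periodic distribution, $\langle v(\cdot,\zeta),\varphi\rangle=\sum_{n\in\mathbb Z}e^{-i\pi n^2\zeta}\widehat\varphi_n$ for smooth $1$-periodic $\varphi$, where $\widehat\varphi_n=\int_{\mathbb T}\varphi(\xi)e^{-2\pi i n\xi}\,d\xi$ and $\mathbb T=\mathbb R/\mathbb Z$. A locally integrable function $f$ of slow growth acts on test functions by $\langle f,\varphi\rangle=\int_{\mathbb R} f\varphi$ (or by $\int_{\mathbb T}f\varphi$ in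 the periodic setting). Convergence $T_r\to T$ in $\mathcal S'(\mathbb R)$ means $\langle T_r,\varphi\rangle\to\langle T,\varphi\rangle$ for every $\varphi\in\mathcal S(\mathbb R)$. For $s\in\mathbb R$, $H^s(\mathbb T)$ is the space of $1$-periodic distributions $f$ with $\|f\|_{H^s(\mathbb T)}^2=\sum_{n\in\mathbb Z}(1+n^2)^s|\widehat f_n|^2<\infty$, and $(H^s(\mathbb T))'=H^{-s}(\mathbb T)$. *)

(* Defs.v *)
From Stdlib Require Import Reals ZArith.
From Coquelicot Require Export Coquelicot.

Open Scope R_scope.

Definition Cexp (z : C) : C :=
  (exp (Re z) * cos (Im z), exp (Re z) * sin (Im z)).

(* The branch of the square root with values in [0,+oo) + i [0,+oo), so that
   csqrt (1 - (n/r)^2) = i sqrt((n/r)^2 - 1) when |n| > r. *)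
Definition csqrt (x : R) : C :=
  if Rle_dec 0 x then RtoC (sqrt x) else (Ci * RtoC (sqrt (- x)))%C.

(* A sum over Z is split into its two halves n >= 0 and n < 0, which must
   converge separately. *)
Definition ex_seriesZ (a : Z -> R) : Prop :=
  ex_series (fun k => a (Z.of_nat k)) /\
  ex_series (fun k => a (- Z.of_nat (S k))%Z).

Definition SeriesZ (a : Z -> R) : R :=
  Series (fun k => a (Z.of_nat k)) + Series (fun k => a (- Z.of_nat (S k))%Z).

Definition CSeriesZ (a : Z -> C) : C :=
  (SeriesZ (fun n => Re (a n)), SeriesZ (fun n => Im (a n))).

Definition CRInt (f : R -> C) (a b : R) : C :=
  RInt (V := C_R_CompleteNormedModule) f a b.

Definition CRInt_line (f : R -> C) : C :=
  RInt_gen (V := C_R_CompleteNormedModule) f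
    (Rbar_locally m_infty) (Rbar_locally p_infty).

Definition Csmooth (f : R -> C) : Prop :=
  forall (k : nat) (x : R),
    ex_derive_n (fun t => Re (f t)) k x /\ ex_derive_n (fun t => Im (f t)) k x.

Definition CDerive_n (f : R -> C) (k : nat) (x : R) : C :=
  (Derive_n (fun t => Re (f t)) k x, Derive_n (fun t => Im (f t)) k x).

(* Distributions are functionals (R -> C) -> C of which only the values on test
   functions matter. *)

Definition linear_on (test : (R -> C) -> Prop) (T : (R -> C) -> C) : Prop :=
  forall (a b : C) (phi psi : R -> C), test phi -> test psi ->
    T (fun x => a * phi x + b * psi x)%C = (a * T phi + b * T psi)%C.

Definition schwartz (phi : R -> C) : Prop :=
  Csmooth phi /\
  forall j k : nat, exists M : R, forall x : R,
    Cmod (RtoC (x ^ j) * CDerive_n phi k x)%C <= M.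

(* The sets [schwartz_nbhd phi0 N delta] form a neighbourhood basis of phi0 for
   the topology given by the seminorms sup_x |x^j phi^(k)(x)|. *)
Definition schwartz_nbhd (phi0 : R -> C) (N : nat) (delta : R)
    (phi : R -> C) : Prop :=
  forall (j k : nat) (x : R), (j <= N)%nat -> (k <= N)%nat ->
    Cmod (RtoC (x ^ j) * CDerive_n (fun t => phi t - phi0 t)%C k x)%C <= delta.

Definition tempered_distribution (T : (R -> C) -> C) : Prop :=
  linear_on schwartz T /\
  forall phi0 : R -> C, schwartz phi0 -> forall eps : R, 0 < eps ->
    exists (N : nat) (delta : R), 0 < delta /\
      forall phi : R -> C, schwartz phi -> schwartz_nbhd phi0 N delta phi ->
        Cmod (T phi - T phi0)%C < eps.

Definition cvg_tempered (T : R -> (R -> C) -> C) (T0 : (R -> C) -> C) : Prop :=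
  (forall r : R, 0 < r -> tempered_distribution (T r)) /\
  tempered_distribution T0 /\
  forall phi : R -> C, schwartz phi ->
    filterlim (fun r => T r phi) (Rbar_locally p_infty) (locally (T0 phi)).

Definition fourier (phi : R -> C) (x : R) : C :=
  CRInt_line (fun xi => phi xi * Cexp (- (2 * PI * Ci * x * xi)))%C.

(* The function f acting by integration over R, and below over one period. *)
Definition fun_tempered (f : R -> C) (phi : R -> C) : C :=
  CRInt_line (fun xi => f xi * phi xi)%C.

Definition periodic_test (phi : R -> C) : Prop :=
  Csmooth phi /\ forall x : R, phi (x + 1) = phi x.

Definition periodic_nbhd (phi0 : R -> C) (N : nat) (delta : R)
    (phi : R -> C) : Prop :=
  forall (k : nat) (x : R), (k <= N)%nat ->
    Cmod (CDerive_n (fun t => phi t - phi0 t)%C k x) <= delta.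

Definition periodic_distribution (T : (R -> C) -> C) : Prop :=
  linear_on periodic_test T /\
  forall phi0 : R -> C, periodic_test phi0 -> forall eps : R, 0 < eps ->
    exists (N : nat) (delta : R), 0 < delta /\
      forall phi : R -> C, periodic_test phi -> periodic_nbhd phi0 N delta phi ->
        Cmod (T phi - T phi0)%C < eps.

Definition fun_periodic (f : R -> C) (phi : R -> C) : C :=
  CRInt (fun xi => f xi * phi xi)%C 0 1.

Definition fourier_character (n : Z) (xi : R) : C :=
  Cexp (2 * PI * Ci * IZR n * xi)%C.

Definition fourier_coef_fun (phi : R -> C) (n : Z) : C :=
  CRInt (fun xi => phi xi * Cexp (- (2 * PI * Ci * IZR n * xi)))%C 0 1.

(* The n-th Fourier coefficient of T is <T, e^{-2 pi i n .}>. *)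
Definition fourier_coef (T : (R -> C) -> C) (n : Z) : C :=
  T (fourier_character (- n)).

Definition sobolev_term (s : R) (T : (R -> C) -> C) (n : Z) : R :=
  Rpower (1 + IZR n ^ 2) s * Cmod (fourier_coef T n) ^ 2.

Definition in_sobolev (s : R) (T : (R -> C) -> C) : Prop :=
  periodic_distribution T /\ ex_seriesZ (sobolev_term s T).

Definition sobolev_norm (s : R) (T : (R -> C) -> C) : R :=
  sqrt (SeriesZ (sobolev_term s T)).

Definition cvg_sobolev (s : R) (T : R -> (R -> C) -> C) (T0 : (R -> C) -> C)
    : Prop :=
  (forall r : R, 0 < r -> in_sobolev s (T r)) /\
  in_sobolev s T0 /\
  is_lim (fun r => sobolev_norm s (fun phi => T r phi - T0 phi)%C) p_infty 0.

Definition w_nonneg (r xi zeta : R) : C :=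
  (Cexp (- (2 * PI * Ci * (r ^ 2)%R * zeta)) *
   CSeriesZ (fun n =>
     Cexp (2 * PI * Ci * (r ^ 2)%R * csqrt (1 - (IZR n / r) ^ 2)%R * zeta) *
     Cexp (2 * PI * Ci * IZR n * xi)))%C.

Definition w (r xi zeta : R) : C :=
  if Rle_dec 0 zeta then w_nonneg r xi zeta else w_nonneg r xi (Rabs zeta).

(* The series sum_n e^{2 pi i n xi - i pi n^2 zeta} does not converge pointwise;
   it is defined by its action on test functions, in each of the two settings. *)
Definition v_tempered (zeta : R) (phi : R -> C) : C :=
  CSeriesZ (fun n =>
    Cexp (- (Ci * PI * (IZR n ^ 2)%R * zeta)) * fourier phi (IZR n))%C.

Definition v_periodic (zeta : R) (phi : R -> C) : C :=
  CSeriesZ (fun n =>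
    Cexp (- (Ci * PI * (IZR n ^ 2)%R * zeta)) * fourier_coef_fun phi n)%C.

(* Main.v *)
Require Import Defs.
From Stdlib Require Import Reals ZArith Lra Lia FunctionalExtensionality.
From Coquelicot Require Import Coquelicot.

(** Write c_r(n) = e^{-2 pi i r^2 zeta} e^{2 pi i r^2 sqrt(1-(n/r)^2) zeta} for the
    coefficients of w_r and c(n) = e^{-i pi n^2 zeta} for those of v. Three facts
    about them carry the proof: |c_r(n)| <= 1 and |c(n)| = 1; for each fixed n,
    c_r(n) -> c(n), because the phase is
    2 pi zeta r^2 (sqrt(1-(n/r)^2) - 1) = -2 pi zeta n^2 / (1 + sqrt(1-(n/r)^2))
    as soon as r > |n| ([w_symbol_cvg]); and for each fixed r the c_r(n) are
    O(1/(1+n^2)), so that w_r is a uniformly convergent Fourier series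
    ([exp_propagator_decay], [w_fourier_series]).

    Both w_r and v act on test functions as phi |-> sum_n c_n phi^(n), where phi^
    is the Fourier transform at the integers, respectively the sequence of
    Fourier coefficients. For w_r this is the interchange of an absolutely
    convergent series with the integral, together with the evenness of c_r
    ([cint_even_fourier_series]). Two integrations by parts bound phi^(n) by a
    seminorm of phi times 1/(1+n^2) ([cos_sin_coef_decay]). Hence every bounded
    symbol c defines a continuous functional ([multiplier_continuous]), and
    pointwise convergence of bounded symbols gives convergence of the functionals
    by dominated convergence of series ([multiplier_cvg]).

    On the circle the n-th Fourier coefficient of such a functional is c(-n)
    ([multiplier_fourier_coef]), so the squared H^{-s} norm of w_r - v is
    sum_n (1+n^2)^{-s} |c_r(-n) - c(-n)|^2. It tends to 0 by dominated convergence,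
    as (1+n^2)^{-s} is summable for s > 1/2 ([ex_seriesZ_Sobolev_weight]).

    The line and the circle are treated together: [integration] axiomatizes
    an integral that is bounded on continuous functions dominated by a weight h
    and kills derivatives, with h(x) = 1/(1+x^2) on the line and h = 1 on a
    period. *)

(** * Series over the integers and dominated convergence *)

Lemma ex_series_Rabs_le (a b : nat -> R) :
  (forall n, Rabs (a n) <= b n) -> ex_series b -> ex_series a.
Proof.
  intros H Hb. apply (ex_series_le (V := R_CompleteNormedModule) a b); trivial.
Qed.

Lemma Series_Rabs_le (a b : nat -> R) :
  (forall n, Rabs (a n) <= b n) -> ex_series b -> Rabs (Series a) <= Series b.
Proof.
  intros H Hb.
  assert (Ha : ex_series (fun n => Rabs (a n))).
  { apply (ex_series_Rabs_le _ b); trivial. intros n. rewrite Rabs_Rabsolu. apply H. }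
  eapply Rle_trans. apply Series_Rabs; trivial.
  apply Series_le; trivial. intros n; split; [apply Rabs_pos | apply H].
Qed.

Lemma Series_tail (b : nat -> R) : ex_series b ->
  is_lim_seq (fun N => Series (fun k => b (S N + k)%nat)) 0.
Proof.
  intros Hb.
  assert (H : is_lim_seq (fun N => Series b - sum_n b N) (Series b - Series b)).
  { apply is_lim_seq_minus'; [apply is_lim_seq_const | apply (Series_correct b Hb)]. }
  rewrite Rminus_diag in H.
  revert H. apply is_lim_seq_ext. intros N.
  rewrite (Series_incr_n b (S N)); [|lia|trivial].
  simpl pred. rewrite sum_n_Reals. ring.
Qed.

(** Dominated convergence for series (Tannery's theorem), along a filter. *)
Lemma filterlim_Series_dominated {T : Type} (F : (T -> Prop) -> Prop)
    {FF : Filter F} (a : T -> nat -> R) (l b : nat -> R) :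
  ex_series b ->
  F (fun t => forall n, Rabs (a t n) <= b n) ->
  (forall n, Rabs (l n) <= b n) ->
  (forall n, filterlim (fun t => a t n) F (locally (l n))) ->
  filterlim (fun t => Series (a t)) F (locally (Series l)).
Proof.
  intros Hb Ha Hl Hlim.
  apply filterlim_locally. intros eps.
  destruct (proj2 (is_lim_seq_spec _ _) (Series_tail b Hb)
    (mkposreal (eps / 4) ltac:(destruct eps; simpl; lra))) as [N HN].
  specialize (HN N (Nat.le_refl N)). rewrite Rminus_0_r in HN.
  change (Rabs (Series (fun k => b (S N + k)%nat)) < eps / 4) in HN.
  assert (Hs : filterlim (fun t => sum_n (a t) N) F (locally (sum_n l N))).
  { generalize N. intros m. induction m as [|m IH].
    - rewrite sum_O. apply filterlim_ext with (2 := Hlim 0%nat).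
      intros t. now rewrite sum_O.
    - rewrite sum_Sn.
      apply filterlim_ext with (fun t => plus (sum_n (a t) m) (a t (S m))).
      { intros t. now rewrite sum_Sn. }
      eapply filterlim_comp_2; [exact IH | exact (Hlim (S m)) |].
      apply (filterlim_plus (V := R_NormedModule)). }
  assert (He2 : 0 < eps / 2) by (destruct eps; simpl; lra).
  pose proof (proj1 (filterlim_locally _ _) Hs (mkposreal _ He2)) as Hs2.
  generalize (filter_and _ _ Ha Hs2). apply filter_imp.
  intros t [H1 H2].
  change (Rabs (sum_n (a t) N - sum_n l N) < eps / 2) in H2.
  change (Rabs (Series (a t) - Series l) < eps).
  assert (Eb : ex_series (fun k => b (S N + k)%nat)) by now apply ex_series_incr_n.
  rewrite (Series_incr_n (a t) (S N)), (Series_incr_n l (S N));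
    [|lia| apply (ex_series_Rabs_le _ b); trivial
     |lia| apply (ex_series_Rabs_le _ b); trivial].
  pose proof (Series_Rabs_le (fun k => a t (S N + k)%nat) _ (fun k => H1 _) Eb).
  pose proof (Series_Rabs_le (fun k => l (S N + k)%nat) _ (fun k => Hl _) Eb).
  rewrite !sum_n_Reals in H2. change (pred (S N)) with N.
  apply Rabs_def2 in H2. apply Rabs_def2 in HN.
  apply Rabs_le_between in H. apply Rabs_le_between in H0.
  apply Rabs_def1; lra.
Qed.

Lemma ex_seriesZ_Rabs_le (a b : Z -> R) :
  (forall n, Rabs (a n) <= b n) -> ex_seriesZ b -> ex_seriesZ a.
Proof.
  intros H [H1 H2]; split; [revert H1 | revert H2];
  apply ex_series_Rabs_le; intros; apply H.
Qed.

Lemma SeriesZ_Rabs_le (a b : Z -> R) :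
  (forall n, Rabs (a n) <= b n) -> ex_seriesZ b -> Rabs (SeriesZ a) <= SeriesZ b.
Proof.
  intros H [H1 H2]. unfold SeriesZ. eapply Rle_trans; [apply Rabs_triang|].
  apply Rplus_le_compat; apply Series_Rabs_le; trivial; intros; apply H.
Qed.

Lemma ex_seriesZ_plus (a b : Z -> R) :
  ex_seriesZ a -> ex_seriesZ b -> ex_seriesZ (fun n => a n + b n).
Proof.
  intros [H1 H2] [H3 H4]; split;
  [apply (ex_series_plus _ _ H1 H3) | apply (ex_series_plus _ _ H2 H4)].
Qed.

Lemma ex_seriesZ_scal (c : R) (a : Z -> R) :
  ex_seriesZ a -> ex_seriesZ (fun n => c * a n).
Proof.
  intros [H1 H2]; split;
  [apply (ex_series_scal_l c _ H1) | apply (ex_series_scal_l c _ H2)].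
Qed.

Lemma SeriesZ_lin (x y : R) (a b : Z -> R) : ex_seriesZ a -> ex_seriesZ b ->
  SeriesZ (fun n => x * a n + y * b n) = x * SeriesZ a + y * SeriesZ b.
Proof.
  intros [H1 H2] [H3 H4]. unfold SeriesZ.
  rewrite !Series_plus, !Series_scal_l; try ring;
  match goal with |- ex_series (fun n => ?c * ?u) =>
    apply (ex_series_scal_l (V := R_NormedModule) c (fun n => u)) end; trivial.
Qed.

Lemma SeriesZ_opp_index (a : Z -> R) : ex_seriesZ a ->
  SeriesZ (fun n => a (- n)%Z) = SeriesZ a.
Proof.
  intros [H1 H2]. unfold SeriesZ.
  rewrite (Series_incr_1 (fun k => a (Z.of_nat k))); trivial.
  rewrite (Series_incr_1 (fun k => a (- Z.of_nat k)%Z)).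
  2: apply ex_series_incr_1; exact H2.
  rewrite (Series_ext (fun k => a (- - Z.of_nat (S k))%Z) (fun k => a (Z.of_nat (S k)))).
  2: intros k; now rewrite Z.opp_involutive.
  change (Z.of_nat 0) with 0%Z. change (- 0)%Z with 0%Z. ring.
Qed.

Lemma Series_single (m : nat) (a : R) :
  is_series (fun k => if Nat.eq_dec k m then a else 0) a.
Proof.
  change (is_lim_seq (sum_n (fun k => if Nat.eq_dec k m then a else 0)) a).
  apply is_lim_seq_ext_loc with (fun _ => a); [|apply is_lim_seq_const].
  exists m. intros n Hn. induction Hn as [|n Hn IH].
  - destruct m as [|m].
    + now rewrite sum_O.
    + rewrite sum_Sn. rewrite (sum_n_ext_loc _ (fun _ => 0)).
      2: { intros k Hk. destruct (Nat.eq_dec k (S m)); [lia|trivial]. }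
      rewrite sum_n_const. destruct (Nat.eq_dec (S m) (S m)) as [_|E]; [|now elim E].
      unfold plus; simpl. ring.
  - rewrite sum_Sn, <- IH. destruct (Nat.eq_dec (S n) m); [lia|].
    unfold plus; simpl. ring.
Qed.

Lemma Series_zero : Series (fun _ => 0) = 0.
Proof.
  rewrite (Series_ext _ (fun k => 0 * 0)) by (intros; ring).
  rewrite Series_scal_l. ring.
Qed.

Lemma SeriesZ_single (m : Z) (a : R) :
  SeriesZ (fun k => if Z.eq_dec k m then a else 0) = a.
Proof.
  unfold SeriesZ. destruct (Z_le_gt_dec 0 m) as [Hm|Hm].
  - rewrite (Series_ext _ (fun k => if Nat.eq_dec k (Z.to_nat m) then a else 0)).
    2: { intros k. destruct Z.eq_dec, Nat.eq_dec; trivial; lia. }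
    rewrite (Series_ext (fun k => if Z.eq_dec (- Z.of_nat (S k)) m then a else 0)
      (fun _ => 0)).
    2: { intros k. destruct Z.eq_dec; trivial; lia. }
    rewrite (is_series_unique _ _ (Series_single _ a)), Series_zero. ring.
  - rewrite (Series_ext (fun k => if Z.eq_dec (Z.of_nat k) m then a else 0)
      (fun _ => 0)).
    2: { intros k. destruct Z.eq_dec; trivial; lia. }
    rewrite (Series_ext (fun k => if Z.eq_dec (- Z.of_nat (S k)) m then a else 0)
      (fun k => if Nat.eq_dec k (Z.to_nat (- m) - 1) then a else 0)).
    2: { intros k. destruct Z.eq_dec, Nat.eq_dec; trivial; lia. }
    rewrite (is_series_unique _ _ (Series_single _ a)), Series_zero. ring.
Qed.

Lemma filterlim_SeriesZ_dominated {T : Type} (F : (T -> Prop) -> Prop)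
    {FF : Filter F} (a : T -> Z -> R) (l b : Z -> R) :
  ex_seriesZ b ->
  F (fun t => forall n, Rabs (a t n) <= b n) ->
  (forall n, Rabs (l n) <= b n) ->
  (forall n, filterlim (fun t => a t n) F (locally (l n))) ->
  filterlim (fun t => SeriesZ (a t)) F (locally (SeriesZ l)).
Proof.
  intros [H1 H2] Ha Hl Hlim. unfold SeriesZ.
  eapply filterlim_comp_2.
  3: exact (filterlim_plus (V := R_NormedModule) (Series (fun k => l (Z.of_nat k)))
       (Series (fun k => l (- Z.of_nat (S k))%Z))).
  - apply (filterlim_Series_dominated F (fun t k => a t (Z.of_nat k))
      (fun k => l (Z.of_nat k)) (fun k => b (Z.of_nat k))); trivial.
    revert Ha; apply filter_imp; intros; trivial.
  - apply (filterlim_Series_dominated F (fun t k => a t (- Z.of_nat (S k))%Z)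
      (fun k => l (- Z.of_nat (S k))%Z) (fun k => b (- Z.of_nat (S k))%Z)); trivial.
    revert Ha; apply filter_imp; intros; trivial.
Qed.

(** Telescoping bound behind the convergence of the p-series with p = a + 1;
    it rests on ln (1 + 1/x) >= 1/(x + 1). *)
Lemma Rpower_telescope (a x : R) : 0 < a -> 0 < x ->
  a * Rpower (x + 1) (- (a + 1)) <= Rpower x (- a) - Rpower (x + 1) (- a).
Proof.
  intros Ha Hx.
  assert (Hl : / (x + 1) <= ln (x + 1) - ln x).
  { assert (H : ln x - ln (x + 1) <= - / (x + 1)).
    { rewrite <- ln_div by lra.
      assert (E : x / (x + 1) = 1 + - / (x + 1)) by (field; lra).
      rewrite E. rewrite <- (ln_exp (- / (x + 1))) at 2.
      apply ln_le; [rewrite <- E; apply Rdiv_lt_0_compat; lra | apply exp_ineq1_le]. }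
    lra. }
  assert (E1 : Rpower x (- a) = Rpower (x + 1) (- a) * exp (a * (ln (x + 1) - ln x))).
  { unfold Rpower. rewrite <- exp_plus. f_equal. ring. }
  assert (E2 : Rpower (x + 1) (- (a + 1)) = Rpower (x + 1) (- a) * / (x + 1)).
  { replace (- (a + 1)) with (- a + - (1)) by ring.
    rewrite Rpower_plus, (Rpower_Ropp (x + 1) 1), Rpower_1; lra. }
  rewrite E1, E2.
  assert (0 < Rpower (x + 1) (- a)) by apply exp_pos.
  pose proof (exp_ineq1_le (a * (ln (x + 1) - ln x))).
  assert (a * / (x + 1) <= a * (ln (x + 1) - ln x)) by (apply Rmult_le_compat_l; lra).
  nra.
Qed.

Lemma ex_series_Rpower (a : R) : 0 < a ->
  ex_series (fun k => Rpower (INR (S k)) (- (a + 1))).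
Proof.
  intros Ha. apply ex_series_incr_1.
  assert (H : ex_series (fun k =>
    Rpower (INR (S k)) (- a) - Rpower (INR (S (S k))) (- a))).
  { (* The partial sums telescope: they are nondecreasing and bounded by 1. *)
    assert (Hs : forall N, sum_n (fun k =>
       Rpower (INR (S k)) (- a) - Rpower (INR (S (S k))) (- a)) N
       = 1 - Rpower (INR (S (S N))) (- a)).
    { induction N as [|N IH].
      - rewrite sum_O. f_equal. unfold Rpower. simpl INR. rewrite ln_1, Rmult_0_r.
        apply exp_0.
      - rewrite sum_Sn, IH. unfold plus. cbn -[INR Rpower]. ring. }
    destruct (ex_finite_lim_seq_incr (sum_n (fun k =>
       Rpower (INR (S k)) (- a) - Rpower (INR (S (S k))) (- a))) 1) as [l Hl].
    - intros N. rewrite sum_Sn.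
      pose proof (Rpower_telescope a (INR (S N + 1)) Ha) as H.
      specialize (H (lt_0_INR (S N + 1) ltac:(lia))).
      replace (INR (S N + 1) + 1) with (INR (S (S (S N)))) in H
        by (rewrite !S_INR, plus_INR, S_INR; simpl; ring).
      replace (S N + 1)%nat with (S (S N)) in H by lia.
      pose proof (exp_pos (- (a + 1) * ln (INR (S (S (S N)))))) as H2.
      fold (Rpower (INR (S (S (S N)))) (- (a + 1))) in H2.
      change (sum_n (fun k : nat => Rpower (INR (S k)) (- a) - Rpower (INR (S (S k))) (- a)) N <= 
        sum_n (fun k : nat => Rpower (INR (S k)) (- a) - Rpower (INR (S (S k))) (- a)) N + 
        (Rpower (INR (S (S N))) (- a) - Rpower (INR (S (S (S N)))) (- a))).
      nra.
    - intros N. rewrite Hs. pose proof (exp_pos (- a * ln (INR (S (S N))))).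
      unfold Rpower. lra.
    - exists l. exact Hl. }
  apply (ex_series_scal_l (/ a)) in H. revert H.
  apply ex_series_Rabs_le. intros k.
  rewrite Rabs_pos_eq by apply Rlt_le, exp_pos.
  pose proof (Rpower_telescope a (INR (S k)) Ha (lt_0_INR (S k) ltac:(lia))) as H.
  rewrite <- S_INR in H. unfold scal; simpl scal. unfold mult; simpl mult.
  apply (Rmult_le_reg_l a); trivial.
  rewrite <- (Rmult_assoc a (/ a)), Rinv_r, Rmult_1_l by lra. exact H.
Qed.

Lemma ex_seriesZ_Sobolev_weight (s : R) : 1 / 2 < s ->
  ex_seriesZ (fun n => Rpower (1 + IZR n ^ 2) (- s)).
Proof.
  intros Hs.
  assert (H : ex_series (fun k => Rpower (1 + IZR (Z.of_nat (S k)) ^ 2) (- s))).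
  { pose proof (ex_series_Rpower (2 * s - 1) ltac:(lra)) as H. revert H.
    apply ex_series_Rabs_le. intros k.
    rewrite Rabs_pos_eq by apply Rlt_le, exp_pos.
    rewrite <- INR_IZR_INZ.
    assert (0 < INR (S k)) by (apply lt_0_INR; lia).
    replace (- (2 * s - 1 + 1)) with (INR 2 * - s) by (simpl; ring).
    rewrite <- Rpower_mult, Rpower_pow by trivial.
    rewrite !Rpower_Ropp. apply Rinv_le_contravar. apply exp_pos.
    apply Rle_Rpower_l; [lra|]. split; [apply pow_lt; trivial | lra]. }
  split.
  - apply ex_series_incr_1. exact H.
  - revert H. apply ex_series_ext. intros k. rewrite opp_IZR. do 2 f_equal. ring.
Qed.

Lemma ex_seriesZ_inv_sqr : ex_seriesZ (fun n => / (1 + IZR n ^ 2)).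
Proof.
  replace (fun n => / (1 + IZR n ^ 2)) with (fun n => Rpower (1 + IZR n ^ 2) (- (1))).
  - apply ex_seriesZ_Sobolev_weight. lra.
  - apply functional_extensionality. intros n.
    rewrite Rpower_Ropp, Rpower_1; trivial.
    pose proof (pow2_ge_0 (IZR n)). lra.
Qed.

(** * Integrals of weighted bounded functions *)

(** The continuous functions of norm at most [M] in the sup norm with weight [h]. *)
Definition wbounded (h : R -> R) (M : R) (f : R -> R) : Prop :=
  (forall x, continuous f x) /\ forall x, Rabs (f x) <= M * h x.

(** A linear functional [J] of norm at most [K] on the functions bounded by
    multiples of [h], vanishing on the derivatives of such functions; when [per]
    holds, only the derivatives of 1-periodic functions are concerned. *)
Record integration (per : Prop) (h : R -> R) (K : R) (J : (R -> R) -> R) : Prop := {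
  int_weight : forall x, 0 < h x <= 1;
  int_const : 0 <= K;
  int_lin : forall a b f g M N, wbounded h M f -> wbounded h N g ->
    J (fun x => a * f x + b * g x) = a * J f + b * J g;
  int_bound : forall f M, wbounded h M f -> Rabs (J f) <= K * M;
  int_deriv : forall F F' M N, (per -> forall x, F (x + 1) = F x) ->
    (forall x, is_derive F x (F' x)) -> wbounded h M F -> wbounded h N F' ->
    J F' = 0 }.

Lemma wbounded_lin h a b f g M N : wbounded h M f -> wbounded h N g ->
  wbounded h (Rabs a * M + Rabs b * N) (fun x => a * f x + b * g x).
Proof.
  intros [Cf Hf] [Cg Hg]; split.
  - intros x. apply (continuous_plus (V := R_NormedModule)
      (fun x => a * f x) (fun x => b * g x)).
    + apply (continuous_scal_r (V := R_NormedModule) a f); trivial.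
    + apply (continuous_scal_r (V := R_NormedModule) b g); trivial.
  - intros x. eapply Rle_trans; [apply Rabs_triang|]. rewrite !Rabs_mult.
    specialize (Hf x). specialize (Hg x).
    pose proof (Rabs_pos a). pose proof (Rabs_pos b). nra.
Qed.

Lemma wbounded_le h f M N : (forall x, 0 < h x) -> M <= N ->
  wbounded h M f -> wbounded h N f.
Proof.
  intros Hh HMN [Cf Hf]; split; trivial. intros x.
  eapply Rle_trans; [apply Hf|]. apply Rmult_le_compat_r; [apply Rlt_le|]; trivial.
Qed.

Lemma wbounded_mult h f g M : (forall x, continuous g x) ->
  (forall x, Rabs (g x) <= 1) -> wbounded h M f -> wbounded h M (fun x => f x * g x).
Proof.
  intros Cg Hg [Cf Hf]; split.
  - intros x. apply (continuous_mult (K := R_AbsRing) f g); trivial.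
  - intros x. rewrite Rabs_mult. specialize (Hf x). specialize (Hg x).
    pose proof (Rabs_pos (f x)). pose proof (Rabs_pos (g x)). nra.
Qed.

(** The n-th Fourier cosine and sine integrals of [f] for the functional [J]. *)
Definition cos_coef (J : (R -> R) -> R) (f : R -> R) (n : Z) : R :=
  J (fun x => f x * cos (2 * PI * IZR n * x)).
Definition sin_coef (J : (R -> R) -> R) (f : R -> R) (n : Z) : R :=
  J (fun x => f x * sin (2 * PI * IZR n * x)).

(** Real test functions: smooth, all derivatives bounded by multiples of the
    weight [h], and 1-periodic when [per] holds. *)
Definition rtest (per : Prop) (h : R -> R) (f : R -> R) : Prop :=
  (forall k x, ex_derive_n f k x) /\
  (forall k, exists M, forall x, Rabs (Derive_n f k x) <= M * h x) /\
  (per -> forall x, f (x + 1) = f x).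

Section Integration.

Context {per : Prop} {h : R -> R} {K : R} {J : (R -> R) -> R}.
Context (HJ : integration per h K J).

Lemma integration_zero : J (fun _ => 0) = 0.
Proof.
  assert (W : wbounded h 0 (fun _ => 0)).
  { split; [intros; apply continuous_const|]. intros x. rewrite Rabs_R0. lra. }
  pose proof (int_bound _ _ _ _ HJ _ _ W) as H. rewrite Rmult_0_r in H.
  revert H. generalize (J (fun _ => 0)). intros y. split_Rabs; lra.
Qed.

Lemma integration_sum_n (f : nat -> R -> R) (b : nat -> R) (N : nat) :
  (forall n, wbounded h (b n) (f n)) ->
  wbounded h (sum_n b N) (fun x => sum_n (fun n => f n x) N) /\
  J (fun x => sum_n (fun n => f n x) N) = sum_n (fun n => J (f n)) N.
Proof.
  intros Hf. induction N as [|N [IH1 IH2]].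
  - replace (fun x => sum_n (fun n => f n x) 0) with (f 0%nat)
      by (apply functional_extensionality; intros; now rewrite sum_O).
    now rewrite !sum_O.
  - replace (fun x => sum_n (fun n => f n x) (S N)) with
      (fun x => 1 * sum_n (fun n => f n x) N + 1 * f (S N) x).
    2: { apply functional_extensionality; intros. rewrite sum_Sn.
         unfold plus; simpl. ring. }
    rewrite !sum_Sn. split.
    + replace (plus (sum_n b N) (b (S N))) with
        (Rabs 1 * sum_n b N + Rabs 1 * b (S N)).
      * now apply wbounded_lin.
      * rewrite Rabs_R1. unfold plus; simpl. ring.
    + rewrite (int_lin _ _ _ _ HJ _ _ _ _ _ _ IH1 (Hf (S N))), IH2.
      unfold plus; simpl. ring.
Qed.

(** Term-by-term integration: by [int_bound], the error at the N-th partial sum is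
    at most [K] times the N-th tail of the dominating series. *)
Lemma integration_Series (f : nat -> R -> R) (b : nat -> R) :
  (forall n, wbounded h (b n) (f n)) -> ex_series b ->
  wbounded h (Series b) (fun x => Series (fun n => f n x)) /\
  J (fun x => Series (fun n => f n x)) = Series (fun n => J (f n)).
Proof.
  intros Hf Hb.
  pose proof (int_weight _ _ _ _ HJ) as Hh.
  assert (Hb0 : forall n, 0 <= b n).
  { intros n. pose proof (proj2 (Hf n) 0). pose proof (Rabs_pos (f n 0)).
    specialize (Hh 0). nra. }
  assert (Hfb : forall x n, Rabs (f n x) <= b n * h x) by (intros; apply Hf).
  assert (Hfb1 : forall x n, Rabs (f n x) <= b n).
  { intros x n. specialize (Hfb x n). specialize (Hb0 n). specialize (Hh x). nra. }
  assert (Hbh : forall x, ex_series (fun n => b n * h x)).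
  { intros x. apply (ex_series_scal_r (h x) b Hb). }
  assert (W : wbounded h (Series b) (fun x => Series (fun n => f n x))).
  { split.
    - intros x. apply (filterlim_Series_dominated (locally x)
        (fun t n => f n t) (fun n => f n x) b); trivial.
      + now apply filter_forall.
      + intros n. apply Hf.
    - intros x. rewrite <- Series_scal_r. now apply Series_Rabs_le. }
  split; trivial. symmetry. apply is_series_unique.
  change (is_lim_seq (sum_n (fun n => J (f n))) (J (fun x => Series (fun n => f n x)))).
  assert (Hd : forall N, Rabs (J (fun x => Series (fun n => f n x)) - sum_n (fun n => J (f n)) N)
     <= K * Series (fun k => b (S N + k)%nat)).
  { intros N. destruct (integration_sum_n f b N Hf) as [W1 E1].
    rewrite <- E1.
    replace (J (fun x => Series (fun n => f n x)) - J (fun x => sum_n (fun n => f n x) N))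
      with (1 * J (fun x => Series (fun n => f n x))
        + (-1) * J (fun x => sum_n (fun n => f n x) N)) by ring.
    rewrite <- (int_lin _ _ _ _ HJ _ _ _ _ _ _ W W1).
    apply (int_bound _ _ _ _ HJ). split.
    - exact (proj1 (wbounded_lin h 1 (-1) _ _ _ _ W W1)).
    - intros x.
      rewrite (Series_incr_n (fun n => f n x) (S N)); [|lia|].
      2: { apply (ex_series_Rabs_le _ b); trivial. }
      rewrite sum_n_Reals. change (pred (S N)) with N.
      match goal with |- Rabs ?u <= _ =>
        replace u with (Series (fun k => f (S N + k)%nat x)) by ring end.
      rewrite <- Series_scal_r. apply Series_Rabs_le; trivial.
      now apply (ex_series_incr_n (fun n => b n * h x)). }
  assert (H0 : is_lim_seq (fun N => K * Series (fun k => b (S N + k)%nat)) 0).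
  { replace (Finite 0) with (Rbar_mult K 0) by (simpl; f_equal; ring).
    apply is_lim_seq_scal_l. now apply Series_tail. }
  set (L := J (fun x => Series (fun n => f n x))) in *.
  apply is_lim_seq_ext with (fun N => L - (L - sum_n (fun n => J (f n)) N)).
  { intros; ring. }
  replace (Finite L) with (Finite (L - 0)) by now rewrite Rminus_0_r.
  apply is_lim_seq_minus'; [apply is_lim_seq_const|].
  apply is_lim_seq_abs_0.
  apply is_lim_seq_le_le with (u := fun _ => 0) (3 := H0).
  - intros N; split; [apply Rabs_pos | apply Hd].
  - apply is_lim_seq_const.
Qed.

Lemma integration_SeriesZ (f : Z -> R -> R) (b : Z -> R) :
  (forall n, wbounded h (b n) (f n)) -> ex_seriesZ b ->
  wbounded h (SeriesZ b) (fun x => SeriesZ (fun n => f n x)) /\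
  J (fun x => SeriesZ (fun n => f n x)) = SeriesZ (fun n => J (f n)).
Proof.
  intros Hf [H1 H2].
  destruct (integration_Series _ _ (fun k => Hf (Z.of_nat k)) H1) as [W1 E1].
  destruct (integration_Series _ _ (fun k => Hf (- Z.of_nat (S k))%Z) H2) as [W2 E2].
  unfold SeriesZ. rewrite <- E1, <- E2.
  replace (fun x => Series (fun k => f (Z.of_nat k) x) +
     Series (fun k => f (- Z.of_nat (S k))%Z x)) with
    (fun x => 1 * Series (fun k => f (Z.of_nat k) x) +
     1 * Series (fun k => f (- Z.of_nat (S k))%Z x))
   by (apply functional_extensionality; intros; ring).
  split.
  - pose proof (wbounded_lin h 1 1 _ _ _ _ W1 W2) as W.
    rewrite !Rabs_R1, !Rmult_1_l in W. exact W.
  - rewrite (int_lin _ _ _ _ HJ _ _ _ _ _ _ W1 W2). ring.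
Qed.



Lemma wbounded_cos f M a : wbounded h M f -> wbounded h M (fun x => f x * cos (a * x)).
Proof.
  apply wbounded_mult.
  - intros x. apply (continuous_comp (fun x => a * x) cos).
    + apply (continuous_scal_r (V := R_NormedModule) a (fun x => x)), continuous_id.
    + apply continuous_cos.
  - intros x. apply Rabs_le, COS_bound.
Qed.

Lemma wbounded_sin f M a : wbounded h M f -> wbounded h M (fun x => f x * sin (a * x)).
Proof.
  apply wbounded_mult.
  - intros x. apply (continuous_comp (fun x => a * x) sin).
    + apply (continuous_scal_r (V := R_NormedModule) a (fun x => x)), continuous_id.
    + apply continuous_sin.
  - intros x. apply Rabs_le, SIN_bound.
Qed.

Lemma cos_shift n x : cos (2 * PI * IZR n * (x + 1)) = cos (2 * PI * IZR n * x).
Proof.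
  replace (2 * PI * IZR n * (x + 1)) with (2 * PI * IZR n * x + 2 * IZR n * PI) by ring.
  destruct (Z_le_gt_dec 0 n) as [H|H].
  - rewrite <- (Z2Nat.id n) at 2 by trivial. rewrite <- INR_IZR_INZ. apply cos_period.
  - rewrite <- (cos_period _ (Z.to_nat (- n))). f_equal.
    rewrite (INR_IZR_INZ (Z.to_nat (- n))), Z2Nat.id, opp_IZR by lia. ring.
Qed.

Lemma sin_shift n x : sin (2 * PI * IZR n * (x + 1)) = sin (2 * PI * IZR n * x).
Proof.
  replace (2 * PI * IZR n * (x + 1)) with (2 * PI * IZR n * x + 2 * IZR n * PI) by ring.
  destruct (Z_le_gt_dec 0 n) as [H|H].
  - rewrite <- (Z2Nat.id n) at 2 by trivial. rewrite <- INR_IZR_INZ. apply sin_period.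
  - rewrite <- (sin_period _ (Z.to_nat (- n))). f_equal.
    rewrite (INR_IZR_INZ (Z.to_nat (- n))), Z2Nat.id, opp_IZR by lia. ring.
Qed.

(** Integration by parts, from the vanishing of [J] on the derivatives of
    f cos and f sin. *)
Lemma cos_sin_coef_deriv f f' M N n : (per -> forall x, f (x + 1) = f x) ->
  (forall x, is_derive f x (f' x)) -> wbounded h M f -> wbounded h N f' ->
  cos_coef J f' n = 2 * PI * IZR n * sin_coef J f n /\ sin_coef J f' n = - (2 * PI * IZR n * cos_coef J f n).
Proof.
  intros Hp Hd Wf Wf'. set (a := 2 * PI * IZR n).
  assert (Ec : forall x, is_derive (fun x => f x * cos (a * x)) x
    (1 * (f' x * cos (a * x)) + (- a) * (f x * sin (a * x)))).
  { intros x. evar_last.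
    - apply (is_derive_mult f (fun x => cos (a * x)) x (f' x) (- a * sin (a * x))).
      + apply Hd.
      + auto_derive; trivial. ring.
      + intros; apply Rmult_comm.
    - unfold plus, mult; simpl. ring. }
  assert (Es : forall x, is_derive (fun x => f x * sin (a * x)) x
    (1 * (f' x * sin (a * x)) + a * (f x * cos (a * x)))).
  { intros x. evar_last.
    - apply (is_derive_mult f (fun x => sin (a * x)) x (f' x) (a * cos (a * x))).
      + apply Hd.
      + auto_derive; trivial. ring.
      + intros; apply Rmult_comm.
    - unfold plus, mult; simpl. ring. }
  pose proof (wbounded_cos _ _ a Wf) as W1. pose proof (wbounded_sin _ _ a Wf) as W2.
  pose proof (wbounded_cos _ _ a Wf') as W3. pose proof (wbounded_sin _ _ a Wf') as W4.
  assert (Pc : per -> forall x, f (x + 1) * cos (a * (x + 1)) = f x * cos (a * x)).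
  { intros p x. unfold a. now rewrite (Hp p), cos_shift. }
  assert (Ps : per -> forall x, f (x + 1) * sin (a * (x + 1)) = f x * sin (a * x)).
  { intros p x. unfold a. now rewrite (Hp p), sin_shift. }
  assert (Hc := int_deriv _ _ _ _ HJ (fun x => f x * cos (a * x)) _ _ _ Pc Ec W1 (wbounded_lin _ _ _ _ _ _ _ W3 W2)).
  assert (Hs := int_deriv _ _ _ _ HJ (fun x => f x * sin (a * x)) _ _ _ Ps Es W2 (wbounded_lin _ _ _ _ _ _ _ W4 W1)).
  rewrite (int_lin _ _ _ _ HJ _ _ _ _ _ _ W3 W2) in Hc.
  rewrite (int_lin _ _ _ _ HJ _ _ _ _ _ _ W4 W1) in Hs.
  unfold cos_coef, sin_coef. fold a. lra.
Qed.

Lemma rtest_wbounded f k : rtest per h f -> exists M, wbounded h M (Derive_n f k).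
Proof.
  intros [H1 [H2 _]]. destruct (H2 k) as [M HM]. exists M. split; trivial.
  intros x. apply (ex_derive_continuous (V := R_NormedModule)), (H1 (S k)).
Qed.

Lemma rtest_minus f g : rtest per h f -> rtest per h g -> rtest per h (fun x => f x - g x).
Proof.
  intros [H1 [H2 H3]] [G1 [G2 G3]].
  assert (E : forall k x, Derive_n (fun x => f x - g x) k x = Derive_n f k x - Derive_n g k x).
  { intros k x. apply Derive_n_minus; now apply filter_forall. }
  repeat split.
  - intros k x. apply ex_derive_n_minus; now apply filter_forall.
  - intros k. destruct (H2 k) as [M HM], (G2 k) as [N HN]. exists (M + N).
    intros x. rewrite E. specialize (HM x). specialize (HN x).
    split_Rabs; lra.
  - intros p x. now rewrite H3, G3.
Qed.

(** Two integrations by parts turn a bound on f'' into quadratic decay. *)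
Lemma cos_sin_coef_decay f M n : rtest per h f -> wbounded h M f -> wbounded h M (Derive_n f 2) ->
  Rabs (cos_coef J f n) <= 2 * K * M * / (1 + IZR n ^ 2) /\
  Rabs (sin_coef J f n) <= 2 * K * M * / (1 + IZR n ^ 2).
Proof.
  intros T W0 W2. destruct (rtest_wbounded f 1 T) as [N W1].
  destruct T as [T1 [_ T3]].
  assert (T3' : per -> forall x, Derive_n f 1 (x + 1) = Derive_n f 1 x).
  { intros p x. rewrite <- Derive_n_comp_trans. apply Derive_n_ext. now apply T3. }
  destruct (cos_sin_coef_deriv f (Derive_n f 1) M N n T3) as [E1 E2]; trivial.
  { intros x. apply Derive_correct, (T1 1%nat). }
  destruct (cos_sin_coef_deriv (Derive_n f 1) (Derive_n f 2) N M n T3') as [E3 E4]; trivial.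
  { intros x. apply Derive_correct, (T1 2%nat). }
  rewrite E2 in E3. rewrite E1 in E4.
  pose proof (int_bound _ _ _ _ HJ _ _ (wbounded_cos _ _ (2 * PI * IZR n) W0)) as B1.
  pose proof (int_bound _ _ _ _ HJ _ _ (wbounded_sin _ _ (2 * PI * IZR n) W0)) as B2.
  pose proof (int_bound _ _ _ _ HJ _ _ (wbounded_cos _ _ (2 * PI * IZR n) W2)) as B3.
  pose proof (int_bound _ _ _ _ HJ _ _ (wbounded_sin _ _ (2 * PI * IZR n) W2)) as B4.
  fold (cos_coef J f n) in B1. fold (sin_coef J f n) in B2.
  fold (cos_coef J (Derive_n f 2) n) in B3. fold (sin_coef J (Derive_n f 2) n) in B4.
  assert (G : forall y z, Rabs y <= K * M -> Rabs z <= K * M ->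
    z = - ((2 * PI * IZR n) ^ 2 * y) -> Rabs y <= 2 * K * M * / (1 + IZR n ^ 2)).
  { intros y z Hy Hz ->. rewrite Rabs_Ropp, Rabs_mult in Hz.
    rewrite (Rabs_pos_eq ((2 * PI * IZR n) ^ 2)) in Hz by apply pow2_ge_0.
    pose proof (pow2_ge_0 (IZR n)) as Hn. pose proof PI_4. pose proof PI2_1.
    apply (Rmult_le_reg_r (1 + IZR n ^ 2)); [lra|].
    rewrite Rmult_assoc, Rinv_l, Rmult_1_r by lra.
    assert (IZR n ^ 2 <= (2 * PI * IZR n) ^ 2).
    { replace ((2 * PI * IZR n) ^ 2) with ((2 * PI) * (2 * PI) * IZR n ^ 2) by ring.
      rewrite <- (Rmult_1_l (IZR n ^ 2)) at 1.
      apply Rmult_le_compat_r; [trivial | nra]. }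
    pose proof (Rabs_pos y).
    assert (IZR n ^ 2 * Rabs y <= (2 * PI * IZR n) ^ 2 * Rabs y)
      by (apply Rmult_le_compat_r; trivial).
    lra. }
  split; [apply (G _ (cos_coef J (Derive_n f 2) n)) | apply (G _ (sin_coef J (Derive_n f 2) n))];
    trivial; [rewrite E3 | rewrite E4]; ring.
Qed.

End Integration.

(** * Complex series and Fourier coefficients *)

Lemma Cmod_le_abs (z : C) (x y : R) : Rabs (Re z) <= x -> Rabs (Im z) <= y ->
  Cmod z <= x + y.
Proof.
  intros Hx Hy. pose proof (Rabs_pos (Re z)). pose proof (Rabs_pos (Im z)).
  unfold Cmod. change (fst z) with (Re z). change (snd z) with (Im z).
  rewrite <- (sqrt_pow2 (x + y)) by lra. apply sqrt_le_1_alt.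
  rewrite <- (pow2_abs (Re z)), <- (pow2_abs (Im z)). nra.
Qed.

Lemma filterlim_C {T : Type} (F : (T -> Prop) -> Prop) {FF : Filter F}
    (f : T -> C) (l : C) :
  filterlim (fun t => Re (f t)) F (locally (Re l)) ->
  filterlim (fun t => Im (f t)) F (locally (Im l)) ->
  filterlim f F (locally l).
Proof.
  intros H1 H2. apply filterlim_locally. intros eps.
  pose proof (proj1 (filterlim_locally _ _) H1 eps) as G1.
  pose proof (proj1 (filterlim_locally _ _) H2 eps) as G2.
  generalize (filter_and _ _ G1 G2). apply filter_imp.
  intros t [A B]. split; [exact A | exact B].
Qed.

(** Domination of both components; it bounds the modulus up to a factor sqrt 2. *)
Definition cdominated (b : Z -> R) (c : Z -> C) : Prop :=
  forall n, Rabs (Re (c n)) <= b n /\ Rabs (Im (c n)) <= b n.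

Lemma Cmult_dom (z w : C) (x y : R) :
  Rabs (Re z) <= x /\ Rabs (Im z) <= x -> Rabs (Re w) <= y /\ Rabs (Im w) <= y ->
  Rabs (Re (z * w)%C) <= 2 * x * y /\ Rabs (Im (z * w)%C) <= 2 * x * y.
Proof.
  destruct z as [z1 z2], w as [w1 w2]. simpl. intros [H1 H2] [H3 H4].
  pose proof (Rabs_pos z1). pose proof (Rabs_pos z2).
  pose proof (Rabs_pos w1). pose proof (Rabs_pos w2).
  assert (G : forall u v, Rabs u <= x -> Rabs v <= y -> Rabs (u * v) <= x * y).
  { intros u v Hu Hv. rewrite Rabs_mult.
    apply Rmult_le_compat; trivial; apply Rabs_pos. }
  pose proof (G _ _ H1 H3) as G1. pose proof (G _ _ H2 H4) as G2.
  pose proof (G _ _ H1 H4) as G3. pose proof (G _ _ H2 H3) as G4.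
  apply Rabs_le_between in G1. apply Rabs_le_between in G2.
  apply Rabs_le_between in G3. apply Rabs_le_between in G4.
  split; apply Rabs_le; lra.
Qed.

Lemma CSeriesZ_lin (a b : C) (u v : Z -> C) (x y : Z -> R) :
  cdominated x u -> cdominated y v -> ex_seriesZ x -> ex_seriesZ y ->
  CSeriesZ (fun n => a * u n + b * v n)%C = (a * CSeriesZ u + b * CSeriesZ v)%C.
Proof.
  intros Hu Hv Hx Hy.
  assert (E1 : ex_seriesZ (fun n => Re (u n))) by (apply (ex_seriesZ_Rabs_le _ x); trivial; apply Hu).
  assert (E2 : ex_seriesZ (fun n => Im (u n))) by (apply (ex_seriesZ_Rabs_le _ x); trivial; apply Hu).
  assert (E3 : ex_seriesZ (fun n => Re (v n))) by (apply (ex_seriesZ_Rabs_le _ y); trivial; apply Hv).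
  assert (E4 : ex_seriesZ (fun n => Im (v n))) by (apply (ex_seriesZ_Rabs_le _ y); trivial; apply Hv).
  destruct a as [a1 a2], b as [b1 b2]. unfold CSeriesZ.
  assert (G : forall p q r s,
    SeriesZ (fun n => 1 * (p * Re (u n) + q * Im (u n)) + 1 * (r * Re (v n) + s * Im (v n)))
    = 1 * (p * SeriesZ (fun n => Re (u n)) + q * SeriesZ (fun n => Im (u n)))
    + 1 * (r * SeriesZ (fun n => Re (v n)) + s * SeriesZ (fun n => Im (v n)))).
  { intros. rewrite <- !SeriesZ_lin; trivial;
    apply ex_seriesZ_plus; now apply ex_seriesZ_scal. }
  apply injective_projections; simpl.
  - replace (fun n => a1 * fst (u n) - a2 * snd (u n) + (b1 * fst (v n) - b2 * snd (v n)))
      with (fun n => 1 * (a1 * Re (u n) + (- a2) * Im (u n)) + 1 * (b1 * Re (v n) + (- b2) * Im (v n)))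
      by (apply functional_extensionality; intros; unfold Re, Im; ring).
    rewrite G. unfold Re, Im. ring.
  - replace (fun n => a1 * snd (u n) + a2 * fst (u n) + (b1 * snd (v n) + b2 * fst (v n)))
      with (fun n => 1 * (a2 * Re (u n) + a1 * Im (u n)) + 1 * (b2 * Re (v n) + b1 * Im (v n)))
      by (apply functional_extensionality; intros; unfold Re, Im; ring).
    rewrite G. unfold Re, Im. ring.
Qed.

Lemma CSeriesZ_opp_index (u : Z -> C) (x : Z -> R) : cdominated x u -> ex_seriesZ x ->
  CSeriesZ (fun n => u (- n)%Z) = CSeriesZ u.
Proof.
  intros Hu Hx. unfold CSeriesZ.
  rewrite (SeriesZ_opp_index (fun n => Re (u n))), (SeriesZ_opp_index (fun n => Im (u n)));
  trivial; apply (ex_seriesZ_Rabs_le _ x); trivial; apply Hu.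
Qed.

Lemma CSeriesZ_dom (u : Z -> C) (x : Z -> R) : cdominated x u -> ex_seriesZ x ->
  Rabs (Re (CSeriesZ u)) <= SeriesZ x /\ Rabs (Im (CSeriesZ u)) <= SeriesZ x.
Proof.
  intros Hu Hx. split; apply (SeriesZ_Rabs_le _ x); trivial; apply Hu.
Qed.

Lemma Cexp_imag (t : R) (z : C) : z = (0, t) -> Cexp z = (cos t, sin t).
Proof. intros ->. unfold Cexp. simpl. rewrite exp_0. now rewrite !Rmult_1_l. Qed.

Lemma fourier_character_E (n : Z) (x : R) :
  fourier_character n x = (cos (2 * PI * IZR n * x), sin (2 * PI * IZR n * x)).
Proof.
  apply Cexp_imag. apply injective_projections; simpl; ring.
Qed.

(** The kernel of the Fourier transform at an integer is a character. *)
Lemma fourier_kernel_E (n : Z) (x : R) :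
  Cexp (- (2 * PI * Ci * IZR n * x))%C = fourier_character (- n) x.
Proof.
  unfold fourier_character. f_equal. rewrite opp_IZR, RtoC_opp. ring.
Qed.

(** Weighted boundedness of both components. *)
Definition cwbounded (h : R -> R) (M : R) (phi : R -> C) : Prop :=
  wbounded h M (fun x => Re (phi x)) /\ wbounded h M (fun x => Im (phi x)).

(** The complex-linear extension of a real integral. *)
Definition cint (J : (R -> R) -> R) (phi : R -> C) : C :=
  (J (fun x => Re (phi x)), J (fun x => Im (phi x))).

(** The Fourier transform of [phi] at the integer [n] for the integral [J]: the
    value of the Fourier transform on the line, the n-th Fourier coefficient on
    the circle. *)
Definition fourier_of (J : (R -> R) -> R) (phi : R -> C) (n : Z) : C :=
  cint J (fun xi => phi xi * Cexp (- (2 * PI * Ci * IZR n * xi)))%C.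

(** The functional with symbol [c]; for even [c], integration against the series
    sum_n c(n) e^{2 pi i n x} when this converges absolutely. *)
Definition multiplier (J : (R -> R) -> R) (c : Z -> C) (phi : R -> C) : C :=
  CSeriesZ (fun n => c n * fourier_of J phi n)%C.

(** Complex test functions, by components. *)
Definition ctest (per : Prop) (h : R -> R) (phi : R -> C) : Prop :=
  rtest per h (fun x => Re (phi x)) /\ rtest per h (fun x => Im (phi x)).

Section Multipliers.

Context {per : Prop} {h : R -> R} {K : R} {J : (R -> R) -> R}.
Context (HJ : integration per h K J).

Lemma cwbounded_lin (a b : C) phi psi M N : cwbounded h M phi -> cwbounded h N psi ->
  (exists L, cwbounded h L (fun x => a * phi x + b * psi x)%C) /\
  cint J (fun x => a * phi x + b * psi x)%C = (a * cint J phi + b * cint J psi)%C.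
Proof.
  intros [W1 W2] [W3 W4]. destruct a as [a1 a2], b as [b1 b2].
  assert (G : forall p q r s,
    wbounded h (Rabs 1 * (Rabs p * M + Rabs q * M) + Rabs 1 * (Rabs r * N + Rabs s * N))
     (fun x => 1 * (p * Re (phi x) + q * Im (phi x)) + 1 * (r * Re (psi x) + s * Im (psi x))) /\
    J (fun x => 1 * (p * Re (phi x) + q * Im (phi x)) + 1 * (r * Re (psi x) + s * Im (psi x)))
    = 1 * (p * J (fun x => Re (phi x)) + q * J (fun x => Im (phi x)))
    + 1 * (r * J (fun x => Re (psi x)) + s * J (fun x => Im (psi x)))).
  { intros.
    pose proof (wbounded_lin h p q _ _ _ _ W1 W2) as W5.
    pose proof (wbounded_lin h r s _ _ _ _ W3 W4) as W6.
    split; [now apply wbounded_lin|].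
    rewrite (int_lin _ _ _ _ HJ _ _ _ _ _ _ W5 W6).
    rewrite (int_lin _ _ _ _ HJ _ _ _ _ _ _ W1 W2).
    rewrite (int_lin _ _ _ _ HJ _ _ _ _ _ _ W3 W4). reflexivity. }
  assert (E1 : (fun x => Re ((a1, a2) * phi x + (b1, b2) * psi x)%C) =
    (fun x => 1 * (a1 * Re (phi x) + (- a2) * Im (phi x)) + 1 * (b1 * Re (psi x) + (- b2) * Im (psi x)))).
  { apply functional_extensionality; intros; unfold Re, Im; simpl; ring. }
  assert (E2 : (fun x => Im ((a1, a2) * phi x + (b1, b2) * psi x)%C) =
    (fun x => 1 * (a2 * Re (phi x) + a1 * Im (phi x)) + 1 * (b2 * Re (psi x) + b1 * Im (psi x)))).
  { apply functional_extensionality; intros; unfold Re, Im; simpl; ring. }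
  destruct (G a1 (- a2) b1 (- b2)) as [G1 G2]. destruct (G a2 a1 b2 b1) as [G3 G4].
  split.
  - exists (Rmax (Rabs 1 * (Rabs a1 * M + Rabs (- a2) * M) + Rabs 1 * (Rabs b1 * N + Rabs (- b2) * N))
     (Rabs 1 * (Rabs a2 * M + Rabs a1 * M) + Rabs 1 * (Rabs b2 * N + Rabs b1 * N))).
    split; [rewrite E1 | rewrite E2]; (eapply wbounded_le; [apply HJ | | eassumption]);
    [apply Rmax_l | apply Rmax_r].
  - unfold cint. rewrite E1, E2, G2, G4.
    apply injective_projections; simpl; ring.
Qed.

Lemma cwbounded_mult phi M (u : R -> C) :
  (forall x, continuous (fun x => Re (u x)) x) ->
  (forall x, continuous (fun x => Im (u x)) x) ->
  (forall x, Rabs (Re (u x)) <= 1 /\ Rabs (Im (u x)) <= 1) ->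
  cwbounded h M phi -> cwbounded h (2 * M) (fun x => phi x * u x)%C.
Proof.
  intros C1 C2 B [W1 W2].
  assert (B1 : forall x, Rabs (Re (u x)) <= 1) by apply B.
  assert (B2 : forall x, Rabs (Im (u x)) <= 1) by apply B.
  pose proof (wbounded_mult _ _ _ _ C1 B1 W1) as W11.
  pose proof (wbounded_mult _ _ _ _ C2 B2 W1) as W12.
  pose proof (wbounded_mult _ _ _ _ C1 B1 W2) as W21.
  pose proof (wbounded_mult _ _ _ _ C2 B2 W2) as W22.
  split.
  - replace (fun x => Re (phi x * u x)%C) with
      (fun x => 1 * (Re (phi x) * Re (u x)) + (-1) * (Im (phi x) * Im (u x)))
      by (apply functional_extensionality; intros; unfold Re, Im; simpl; ring).
    replace (2 * M) with (Rabs 1 * M + Rabs (-1) * M)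
      by (rewrite Rabs_R1, Rabs_left; lra).
    now apply wbounded_lin.
  - replace (fun x => Im (phi x * u x)%C) with
      (fun x => 1 * (Re (phi x) * Im (u x)) + 1 * (Im (phi x) * Re (u x)))
      by (apply functional_extensionality; intros; unfold Re, Im; simpl; ring).
    replace (2 * M) with (Rabs 1 * M + Rabs 1 * M) by (rewrite Rabs_R1; lra).
    now apply wbounded_lin.
Qed.

Lemma cwbounded_character phi M n : cwbounded h M phi ->
  cwbounded h (2 * M) (fun x => phi x * fourier_character n x)%C.
Proof.
  assert (C1 : forall x, continuous (fun x => 2 * PI * IZR n * x) x).
  { intros x. apply (continuous_scal_r (V := R_NormedModule) (2 * PI * IZR n) (fun x => x)).
    apply continuous_id. }
  apply cwbounded_mult.
  - intros x. apply continuous_ext with (fun x => cos (2 * PI * IZR n * x)).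
    { intros y. now rewrite fourier_character_E. }
    apply (continuous_comp _ cos); trivial. apply continuous_cos.
  - intros x. apply continuous_ext with (fun x => sin (2 * PI * IZR n * x)).
    { intros y. now rewrite fourier_character_E. }
    apply (continuous_comp _ sin); trivial. apply continuous_sin.
  - intros x. rewrite fourier_character_E. simpl.
    split; apply Rabs_le; [apply COS_bound | apply SIN_bound].
Qed.

Lemma fourier_of_eq phi n :
  fourier_of J phi n = cint J (fun x => phi x * fourier_character (- n) x)%C.
Proof.
  unfold fourier_of. f_equal. apply functional_extensionality. intros x.
  now rewrite fourier_kernel_E.
Qed.

Lemma fourier_of_cos_sin phi M n : cwbounded h M phi ->
  fourier_of J phi n =
    (cos_coef J (fun x => Re (phi x)) n + sin_coef J (fun x => Im (phi x)) n,
     cos_coef J (fun x => Im (phi x)) n - sin_coef J (fun x => Re (phi x)) n).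
Proof.
  intros [W1 W2]. rewrite fourier_of_eq. unfold cint, cos_coef, sin_coef.
  pose proof (wbounded_cos _ _ (2 * PI * IZR n) W1) as W3.
  pose proof (wbounded_sin _ _ (2 * PI * IZR n) W1) as W4.
  pose proof (wbounded_cos _ _ (2 * PI * IZR n) W2) as W5.
  pose proof (wbounded_sin _ _ (2 * PI * IZR n) W2) as W6.
  f_equal.
  - replace (fun x => Re (phi x * fourier_character (- n) x)%C) with
      (fun x => 1 * (Re (phi x) * cos (2 * PI * IZR n * x))
        + 1 * (Im (phi x) * sin (2 * PI * IZR n * x))).
    + rewrite (int_lin _ _ _ _ HJ _ _ _ _ _ _ W3 W6). ring.
    + apply functional_extensionality; intros x. rewrite fourier_character_E, opp_IZR.
      replace (2 * PI * - IZR n * x) with (- (2 * PI * IZR n * x)) by ring.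
      rewrite cos_neg, sin_neg. unfold Re, Im; simpl. ring.
  - replace (fun x => Im (phi x * fourier_character (- n) x)%C) with
      (fun x => 1 * (Im (phi x) * cos (2 * PI * IZR n * x))
        + (-1) * (Re (phi x) * sin (2 * PI * IZR n * x))).
    + rewrite (int_lin _ _ _ _ HJ _ _ _ _ _ _ W5 W4). ring.
    + apply functional_extensionality; intros x. rewrite fourier_character_E, opp_IZR.
      replace (2 * PI * - IZR n * x) with (- (2 * PI * IZR n * x)) by ring.
      rewrite cos_neg, sin_neg. unfold Re, Im; simpl. ring.
Qed.

Lemma fourier_of_lin (a b : C) phi psi M N n : cwbounded h M phi -> cwbounded h N psi ->
  fourier_of J (fun x => a * phi x + b * psi x)%C n = (a * fourier_of J phi n + b * fourier_of J psi n)%C.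
Proof.
  intros W1 W2. rewrite !fourier_of_eq.
  destruct (cwbounded_lin a b _ _ _ _ (cwbounded_character _ _ (- n) W1)
    (cwbounded_character _ _ (- n) W2)) as [_ <-].
  f_equal. apply functional_extensionality; intros x. ring.
Qed.

Lemma fourier_of_decay phi M : ctest per h phi -> cwbounded h M phi ->
  cwbounded h M (CDerive_n phi 2) ->
  cdominated (fun n => 4 * K * M * / (1 + IZR n ^ 2)) (fourier_of J phi).
Proof.
  intros [T1 T2] [W1 W2] [D1 D2] n.
  rewrite (fourier_of_cos_sin phi M n (conj W1 W2)). simpl Re; simpl Im.
  destruct (cos_sin_coef_decay HJ _ M n T1 W1 D1) as [B1 B2].
  destruct (cos_sin_coef_decay HJ _ M n T2 W2 D2) as [B3 B4].
  apply Rabs_le_between in B1. apply Rabs_le_between in B2.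
  apply Rabs_le_between in B3. apply Rabs_le_between in B4.
  split; apply Rabs_le; lra.
Qed.

(** The two seminorms that control the functionals below. *)
Lemma ctest_cwbounded phi : ctest per h phi ->
  exists M, cwbounded h M phi /\ cwbounded h M (CDerive_n phi 2).
Proof.
  intros [T1 T2].
  destruct (rtest_wbounded _ 0 T1) as [M1 W1], (rtest_wbounded _ 0 T2) as [M2 W2].
  destruct (rtest_wbounded _ 2 T1) as [M3 W3], (rtest_wbounded _ 2 T2) as [M4 W4].
  exists (Rmax (Rmax M1 M2) (Rmax M3 M4)).
  assert (Hh : forall x, 0 < h x) by apply HJ.
  pose proof (Rmax_l M1 M2). pose proof (Rmax_r M1 M2).
  pose proof (Rmax_l M3 M4). pose proof (Rmax_r M3 M4).
  pose proof (Rmax_l (Rmax M1 M2) (Rmax M3 M4)). pose proof (Rmax_r (Rmax M1 M2) (Rmax M3 M4)).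
  split; split; (eapply wbounded_le; [exact Hh | | eassumption]); lra.
Qed.

Lemma ctest_minus phi psi : ctest per h phi -> ctest per h psi ->
  ctest per h (fun x => phi x - psi x)%C.
Proof.
  intros [T1 T2] [T3 T4]. split.
  - apply (rtest_minus _ _ T1 T3).
  - apply (rtest_minus _ _ T2 T4).
Qed.

(** * Fourier multipliers with bounded symbol *)

Lemma multiplier_term_dom c phi M : cdominated (fun _ => 1) c -> ctest per h phi ->
  cwbounded h M phi -> cwbounded h M (CDerive_n phi 2) ->
  cdominated (fun n => 8 * K * M * / (1 + IZR n ^ 2)) (fun n => c n * fourier_of J phi n)%C.
Proof.
  intros Hc T W D n.
  replace (8 * K * M * / (1 + IZR n ^ 2)) with (2 * 1 * (4 * K * M * / (1 + IZR n ^ 2))) by ring.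
  apply Cmult_dom; [apply Hc | now apply fourier_of_decay].
Qed.

Lemma multiplier_lin c a b phi psi : cdominated (fun _ => 1) c -> ctest per h phi -> ctest per h psi ->
  multiplier J c (fun x => a * phi x + b * psi x)%C =
  (a * multiplier J c phi + b * multiplier J c psi)%C.
Proof.
  intros Hc T1 T2.
  destruct (ctest_cwbounded _ T1) as [M [W1 D1]], (ctest_cwbounded _ T2) as [N [W2 D2]].
  unfold multiplier.
  rewrite <- (CSeriesZ_lin a b _ _ _ _ (multiplier_term_dom _ _ _ Hc T1 W1 D1)
    (multiplier_term_dom _ _ _ Hc T2 W2 D2)); try apply ex_seriesZ_scal, ex_seriesZ_inv_sqr.
  f_equal. apply functional_extensionality; intros n.
  rewrite (fourier_of_lin a b _ _ _ _ n W1 W2). ring.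
Qed.

Lemma multiplier_bound c phi M : cdominated (fun _ => 1) c -> ctest per h phi ->
  cwbounded h M phi -> cwbounded h M (CDerive_n phi 2) ->
  Cmod (multiplier J c phi) <= 16 * K * SeriesZ (fun n => / (1 + IZR n ^ 2)) * M.
Proof.
  intros Hc T W D.
  destruct (CSeriesZ_dom _ _ (multiplier_term_dom c phi M Hc T W D)) as [B1 B2].
  { apply ex_seriesZ_scal, ex_seriesZ_inv_sqr. }
  eapply Rle_trans; [exact (Cmod_le_abs _ _ _ B1 B2)|].
  replace (fun n => 8 * K * M * / (1 + IZR n ^ 2)) with
   (fun n => 8 * K * M * / (1 + IZR n ^ 2) + 0 * / (1 + IZR n ^ 2))
   by (apply functional_extensionality; intros; ring).
  rewrite SeriesZ_lin by apply ex_seriesZ_inv_sqr. lra.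
Qed.

Lemma multiplier_cvg (F : (R -> Prop) -> Prop) {FF : Filter F}
    (c : R -> Z -> C) (l : Z -> C) phi :
  F (fun r => cdominated (fun _ => 1) (c r)) -> cdominated (fun _ => 1) l ->
  (forall n, filterlim (fun r => Re (c r n)) F (locally (Re (l n)))) ->
  (forall n, filterlim (fun r => Im (c r n)) F (locally (Im (l n)))) ->
  ctest per h phi ->
  filterlim (fun r => multiplier J (c r) phi) F (locally (multiplier J l phi)).
Proof.
  intros Hc Hl H1 H2 T. destruct (ctest_cwbounded _ T) as [M [W D]].
  assert (Lin : forall (p q : R) (u v : R -> R) (x y : R),
    filterlim u F (locally x) -> filterlim v F (locally y) ->
    filterlim (fun r => p * u r + q * v r) F (locally (p * x + q * y))).
  { intros p q u v x y Hu Hv. eapply filterlim_comp_2.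
    - eapply filterlim_comp; [exact Hu|].
      apply (filterlim_scal_r (V := R_NormedModule) p x).
    - eapply filterlim_comp; [exact Hv|].
      apply (filterlim_scal_r (V := R_NormedModule) q y).
    - apply (filterlim_plus (V := R_NormedModule)). }
  apply filterlim_C; trivial;
  [ change (filterlim (fun r => SeriesZ (fun n => Re (c r n * fourier_of J phi n)%C)) F
      (locally (SeriesZ (fun n => Re (l n * fourier_of J phi n)%C))))
  | change (filterlim (fun r => SeriesZ (fun n => Im (c r n * fourier_of J phi n)%C)) F
      (locally (SeriesZ (fun n => Im (l n * fourier_of J phi n)%C)))) ];
  (eapply filterlim_SeriesZ_dominated with (b := fun n => 8 * K * M * / (1 + IZR n ^ 2));
   [trivial
   | apply ex_seriesZ_scal, ex_seriesZ_inv_sqr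
   | revert Hc; apply filter_imp; intros r Hr n; now apply multiplier_term_dom
   | intros n; now apply multiplier_term_dom
   | intros n; destruct (fourier_of J phi n) as [x y]]).
  - replace (Re (l n * (x, y))%C) with (x * Re (l n) + (- y) * Im (l n))
      by (unfold Re, Im; simpl; ring).
    apply filterlim_ext with (fun r => x * Re (c r n) + (- y) * Im (c r n)).
    { intros r; unfold Re, Im; simpl; ring. }
    now apply Lin.
  - replace (Im (l n * (x, y))%C) with (y * Re (l n) + x * Im (l n))
      by (unfold Re, Im; simpl; ring).
    apply filterlim_ext with (fun r => y * Re (c r n) + x * Im (c r n)).
    { intros r; unfold Re, Im; simpl; ring. }
    now apply Lin.
Qed.

(** Interchange of an absolutely convergent Fourier series with the integral. The
    reflected index is due to the kernel e^{-2 pi i n x} of the Fourier transform. *)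
Lemma cint_fourier_series c b phi M : cdominated b c -> ex_seriesZ b -> cwbounded h M phi ->
  (exists L, cwbounded h L
     (fun x => CSeriesZ (fun n => c n * fourier_character n x) * phi x)%C) /\
  cint J (fun x => CSeriesZ (fun n => c n * fourier_character n x) * phi x)%C =
  CSeriesZ (fun n => c n * fourier_of J phi (- n))%C.
Proof.
  intros Hc Hb W.
  (* The zero multiple puts each term in the shape of [cwbounded_lin]. *)
  assert (Wn : forall n, cwbounded h (4 * M * b n)
    (fun x => c n * (phi x * fourier_character n x) + 0 * (phi x * fourier_character n x))%C).
  { intros n. pose proof (cwbounded_character _ _ n W) as Wn.
    destruct (cwbounded_lin (c n) 0 _ _ _ _ Wn Wn) as [[L [WL1 WL2]] _].
    assert (B : forall x, Rabs (Re (c n * (phi x * fourier_character n x) + 0 * (phi x * fourier_character n x))%C) <= 4 * M * b n * h x /\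
      Rabs (Im (c n * (phi x * fourier_character n x) + 0 * (phi x * fourier_character n x))%C) <= 4 * M * b n * h x).
    { intros x. rewrite Cmult_0_l, Cplus_0_r.
      replace (4 * M * b n * h x) with (2 * b n * (2 * M * h x)) by ring.
      apply Cmult_dom; [apply Hc|].
      split; [apply (proj1 Wn) | apply (proj2 Wn)]. }
    split; split.
    - apply WL1.
    - apply B.
    - apply WL2.
    - apply B. }
  assert (E : (fun x => CSeriesZ (fun n => c n * fourier_character n x) * phi x)%C =
    (fun x => CSeriesZ (fun n => c n * (phi x * fourier_character n x)
       + 0 * (phi x * fourier_character n x)))%C).
  { apply functional_extensionality; intros x.
    assert (Hd : cdominated (fun n => 2 * b n * 1) (fun n => c n * fourier_character n x)%C).
    { intros n. apply Cmult_dom; [apply Hc|]. rewrite fourier_character_E; simpl.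
      split; apply Rabs_le; [apply COS_bound | apply SIN_bound]. }
    assert (Hd2 : ex_seriesZ (fun n => 2 * b n * 1)).
    { replace (fun n => 2 * b n * 1) with (fun n => 2 * b n)
        by (apply functional_extensionality; intros; ring).
      now apply ex_seriesZ_scal. }
    transitivity (phi x * CSeriesZ (fun n => c n * fourier_character n x) +
      0 * CSeriesZ (fun n => c n * fourier_character n x))%C; [ring|].
    rewrite <- (CSeriesZ_lin _ _ _ _ _ _ Hd Hd Hd2 Hd2). f_equal.
    apply functional_extensionality; intros n. ring. }
  assert (Hb4 : ex_seriesZ (fun n => 4 * M * b n)) by now apply ex_seriesZ_scal.
  destruct (integration_SeriesZ HJ _ _ (fun n => proj1 (Wn n)) Hb4) as [W1 E1].
  destruct (integration_SeriesZ HJ _ _ (fun n => proj2 (Wn n)) Hb4) as [W2 E2].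
  rewrite E. split.
  - eexists; split; [exact W1 | exact W2].
  - transitivity (CSeriesZ (fun n => cint J (fun x => c n * (phi x * fourier_character n x)
       + 0 * (phi x * fourier_character n x))%C)).
    + apply injective_projections; [exact E1 | exact E2].
    + f_equal. apply functional_extensionality; intros n.
      pose proof (cwbounded_character _ _ n W) as Wc.
      rewrite (proj2 (cwbounded_lin (c n) 0 _ _ _ _ Wc Wc)).
      rewrite fourier_of_eq, Z.opp_involutive. ring.
Qed.

Lemma fourier_of_bound phi M : cwbounded h M phi -> cdominated (fun _ => K * (2 * M)) (fourier_of J phi).
Proof.
  intros W n. rewrite fourier_of_eq. destruct (cwbounded_character _ _ (- n) W) as [W1 W2].
  split; [exact (int_bound _ _ _ _ HJ _ _ W1) | exact (int_bound _ _ _ _ HJ _ _ W2)].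
Qed.

Lemma cint_even_fourier_series c b phi M : cdominated b c -> ex_seriesZ b ->
  (forall n, c (- n)%Z = c n) -> cwbounded h M phi ->
  cint J (fun x => CSeriesZ (fun n => c n * fourier_character n x) * phi x)%C =
  multiplier J c phi.
Proof.
  intros Hc Hb He W.
  rewrite (proj2 (cint_fourier_series c b phi M Hc Hb W)).
  unfold multiplier.
  rewrite <- (CSeriesZ_opp_index (fun n => c n * fourier_of J phi n)%C
    (fun n => 2 * (K * (2 * M)) * b n)).
  - f_equal. apply functional_extensionality; intros n. now rewrite He.
  - intros n. replace (2 * (K * (2 * M)) * b n) with (2 * b n * (K * (2 * M))) by ring.
    apply Cmult_dom; [apply Hc | now apply fourier_of_bound].
  - now apply ex_seriesZ_scal.
Qed.

Lemma multiplier_continuous c phi psi M : cdominated (fun _ => 1) c -> ctest per h phi -> ctest per h psi ->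
  cwbounded h M (fun x => phi x - psi x)%C ->
  cwbounded h M (CDerive_n (fun x => phi x - psi x)%C 2) ->
  Cmod (multiplier J c phi - multiplier J c psi)%C
    <= 16 * K * SeriesZ (fun n => / (1 + IZR n ^ 2)) * M.
Proof.
  intros Hc T1 T2 W D.
  replace (multiplier J c phi - multiplier J c psi)%C with
    (1 * multiplier J c phi + (- (1)) * multiplier J c psi)%C by ring.
  rewrite <- multiplier_lin by trivial.
  replace (fun x => 1 * phi x + - (1) * psi x)%C with (fun x => phi x - psi x)%C
    by (apply functional_extensionality; intros; ring).
  apply multiplier_bound; trivial. now apply ctest_minus.
Qed.

End Multipliers.

(** * The integral over the line *)

Lemma filterlim_atan_p_infty : filterlim atan (Rbar_locally p_infty) (locally (PI / 2)).
Proof.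
  apply filterlim_locally. intros eps.
  pose proof (cond_pos eps) as He. pose proof PI_RGT_0.
  set (e := Rmin eps (PI / 2)).
  assert (0 < e <= PI / 2) by (unfold e, Rmin; destruct Rle_dec; lra).
  assert (e <= eps) by apply Rmin_l.
  exists (tan (PI / 2 - e)). intros x Hx.
  apply atan_increasing in Hx. rewrite atan_tan in Hx by lra.
  pose proof (atan_bound x).
  change (Rabs (atan x - PI / 2) < eps). apply Rabs_def1; lra.
Qed.

Lemma filterlim_atan_m_infty : filterlim atan (Rbar_locally m_infty) (locally (- (PI / 2))).
Proof.
  apply filterlim_locally. intros eps.
  destruct (proj1 (filterlim_locally _ _) filterlim_atan_p_infty eps) as [M HM].
  exists (- M). intros x Hx. specialize (HM (- x) ltac:(lra)).
  change (Rabs (atan (- x) - PI / 2) < eps) in HM.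
  change (Rabs (atan x - - (PI / 2)) < eps).
  rewrite atan_opp in HM. revert HM. split_Rabs; lra.
Qed.

(** The weight 1/(1+x^2), with primitive arctan and total mass pi. *)
Definition cauchy_weight (x : R) : R := / (1 + x ^ 2).

Lemma cauchy_weight_pos x : 0 < cauchy_weight x <= 1.
Proof.
  unfold cauchy_weight. pose proof (pow2_ge_0 x).
  split; [apply Rinv_0_lt_compat; lra|].
  rewrite <- Rinv_1. apply Rinv_le_contravar; lra.
Qed.

Lemma is_derive_atan_weight x : is_derive atan x (cauchy_weight x).
Proof.
  unfold cauchy_weight. replace (x ^ 2) with (Rsqr x) by (unfold Rsqr; ring).
  apply is_derive_atan.
Qed.

Lemma continuous_cauchy_weight x : continuous cauchy_weight x.
Proof.
  apply (ex_derive_continuous (V := R_NormedModule)). unfold cauchy_weight.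
  auto_derive. pose proof (pow2_ge_0 x). lra.
Qed.

Lemma is_RInt_cauchy_weight a b : is_RInt cauchy_weight a b (atan b - atan a).
Proof.
  apply (is_RInt_derive (V := R_CompleteNormedModule) atan cauchy_weight).
  - intros x _. apply is_derive_atan_weight.
  - intros x _. apply continuous_cauchy_weight.
Qed.

Lemma wbounded_ex_RInt h M f a b : wbounded h M f -> ex_RInt f a b.
Proof.
  intros W. apply (ex_RInt_continuous (V := R_CompleteNormedModule)). intros; apply W.
Qed.

(** Integrals over intervals are controlled by increments of arctan; this gives
    the Cauchy criterion for the improper integral. *)
Lemma RInt_weight_le M f u v : wbounded cauchy_weight M f ->
  Rabs (RInt f u v) <= M * Rabs (atan v - atan u).
Proof.
  intros W.
  assert (G : forall u v, u <= v -> Rabs (RInt f u v) <= M * (atan v - atan u)).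
  { clear u v. intros u v Huv.
    apply (norm_RInt_le (V := R_NormedModule) f (fun x => M * cauchy_weight x) u v _ _ Huv).
    - intros x _. apply W.
    - apply (RInt_correct (V := R_CompleteNormedModule)). eapply wbounded_ex_RInt; eauto.
    - apply (is_RInt_scal (V := R_NormedModule) cauchy_weight u v M _ (is_RInt_cauchy_weight u v)). }
  assert (HM : 0 <= M).
  { pose proof (proj2 W 0). pose proof (Rabs_pos (f 0)).
    pose proof (cauchy_weight_pos 0). nra. }
  destruct (Rle_dec u v) as [H|H].
  - eapply Rle_trans; [apply G; trivial|]. apply Rmult_le_compat_l; trivial. apply Rle_abs.
  - rewrite <- opp_RInt_swap by (eapply wbounded_ex_RInt; eauto).
    change (Rabs (- RInt f v u) <= M * Rabs (atan v - atan u)).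
    rewrite Rabs_Ropp, Rabs_minus_sym.
    eapply Rle_trans; [apply G; lra|]. apply Rmult_le_compat_l; trivial. apply Rle_abs.
Qed.

(** Convergence of the improper integral along a filter [F] of endpoints on which
    arctan converges; it is used at both infinities. *)
Lemma wbounded_ex_RInt_half M f l (F : (R -> Prop) -> Prop) {FF : ProperFilter F} :
  wbounded cauchy_weight M f -> filterlim atan F (locally l) ->
  ex_RInt_gen f (at_point 0) F.
Proof.
  intros W Hl.
  destruct (proj1 (Hierarchy.filterlim_locally_cauchy (U := R_CompleteSpace) (F := F)
    (fun t => RInt f 0 t))) as [y Hy].
  - intros eps. set (d := eps / (2 * (Rabs M + 1))).
    pose proof (Rabs_pos M) as HM. pose proof (cond_pos eps) as He.
    assert (Hd : 0 < d) by (apply Rdiv_lt_0_compat; lra).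
    pose proof (proj1 (filterlim_locally _ _) Hl (mkposreal d Hd)) as P.
    eexists; split; [exact P|]. intros u v Pu Pv.
    change (Rabs (atan u - l) < d) in Pu. change (Rabs (atan v - l) < d) in Pv.
    change (Rabs (RInt f 0 v - RInt f 0 u) < eps).
    rewrite <- (RInt_Chasles f 0 u v) by (eapply wbounded_ex_RInt; eauto).
    change (Rabs (RInt f 0 u + RInt f u v - RInt f 0 u) < eps).
    assert (E : forall p q : R, p + q - p = q) by (intros; ring). rewrite E.
    eapply Rle_lt_trans; [apply RInt_weight_le; eauto|].
    assert (H1 : Rabs (atan v - atan u) < 2 * d) by (revert Pu Pv; split_Rabs; lra).
    assert (H2 : eps = (Rabs M + 1) * (2 * d) :> R) by (unfold d; field; lra).
    rewrite H2. pose proof (Rle_abs M). pose proof (Rabs_pos (atan v - atan u)). nra.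
  - exists y. intros P HP. unfold filtermapi.
    apply (Filter_prod _ _ _ (fun a => a = 0) (fun t => P (RInt f 0 t))).
    + reflexivity.
    + apply Hy, HP.
    + intros a t -> Ht. exists (RInt f 0 t). split; trivial.
      apply (RInt_correct (V := R_CompleteNormedModule)). eapply wbounded_ex_RInt; eauto.
Qed.

(** The improper Riemann integral over R. *)
Definition line_integral (f : R -> R) : R :=
  RInt_gen f (Rbar_locally m_infty) (Rbar_locally p_infty).

Lemma is_RInt_line M f : wbounded cauchy_weight M f ->
  is_RInt_gen f (Rbar_locally m_infty) (Rbar_locally p_infty) (line_integral f).
Proof.
  intros W. apply (RInt_gen_correct (V := R_CompleteNormedModule)).
  destruct (wbounded_ex_RInt_half M f _ _ W filterlim_atan_m_infty) as [y1 H1].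
  destruct (wbounded_ex_RInt_half M f _ _ W filterlim_atan_p_infty) as [y2 H2].
  apply is_RInt_gen_swap in H1.
  eexists. exact (is_RInt_gen_Chasles f 0 _ _ H1 H2).
Qed.

Lemma line_integral_unique f (l : R) :
  is_RInt_gen f (Rbar_locally m_infty) (Rbar_locally p_infty) l -> line_integral f = l.
Proof. exact (is_RInt_gen_unique (V := R_CompleteNormedModule) f l). Qed.

Lemma line_le_ends :
  filter_prod (Rbar_locally m_infty) (Rbar_locally p_infty)
    (fun ab : R * R => fst ab <= snd ab).
Proof.
  apply (Filter_prod _ _ _ (fun a => a < 0) (fun b => 0 < b)).
  - exists 0; trivial.
  - exists 0; trivial.
  - intros a b Ha Hb; simpl; lra.
Qed.

Lemma cauchy_weight_vanishes M f : (forall x, Rabs (f x) <= M * cauchy_weight x) ->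
  filterlim f (Rbar_locally m_infty) (locally 0) /\
  filterlim f (Rbar_locally p_infty) (locally 0).
Proof.
  intros Hf.
  assert (HM : 0 <= M).
  { pose proof (Hf 0). pose proof (Rabs_pos (f 0)).
    pose proof (cauchy_weight_pos 0). nra. }
  assert (G : forall (eps : posreal) x, M / eps < Rabs x -> ball 0 eps (f x)).
  { intros eps x Hx. change (Rabs (f x - 0) < eps). rewrite Rminus_0_r.
    pose proof (cond_pos eps) as He.
    eapply Rle_lt_trans; [apply Hf|]. unfold cauchy_weight.
    rewrite <- (pow2_abs x). pose proof (pow2_ge_0 (Rabs x)).
    apply (Rmult_lt_reg_r (1 + Rabs x ^ 2)); [lra|].
    rewrite Rmult_assoc, Rinv_l, Rmult_1_r by lra.
    assert (H1 : M < eps * Rabs x).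
    { apply (Rmult_lt_compat_l eps) in Hx; trivial.
      replace (eps * (M / eps)) with M in Hx by (field; lra). exact Hx. }
    assert (Rabs x < 1 + Rabs x ^ 2) by nra. nra. }
  split; apply filterlim_locally; intros eps.
  - exists (- (M / eps)). intros x Hx. apply G. split_Rabs; lra.
  - exists (M / eps). intros x Hx. apply G. split_Rabs; lra.
Qed.

Lemma line_integration : integration False cauchy_weight PI line_integral.
Proof.
  split.
  - apply cauchy_weight_pos.
  - apply Rlt_le, PI_RGT_0.
  - intros a b f g M N Wf Wg.
    apply line_integral_unique.
    apply (is_RInt_gen_plus (V := R_NormedModule) (fun x => a * f x) (fun x => b * g x)
       (a * line_integral f) (b * line_integral g)).
    + apply (is_RInt_gen_scal (V := R_NormedModule) f a). eapply is_RInt_line; eauto.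
    + apply (is_RInt_gen_scal (V := R_NormedModule) g b). eapply is_RInt_line; eauto.
  - intros f M W.
    assert (Hw : is_RInt_gen cauchy_weight (Rbar_locally m_infty) (Rbar_locally p_infty) PI).
    { replace PI with (PI / 2 - - (PI / 2)) by lra.
      replace cauchy_weight with (Derive atan).
      - apply is_RInt_gen_Derive.
        + apply filter_forall. intros ab x _. eexists. apply is_derive_atan_weight.
        + apply filter_forall. intros ab x _.
          apply continuous_ext with cauchy_weight; [|apply continuous_cauchy_weight].
          intros y. symmetry. apply is_derive_unique, is_derive_atan_weight.
        + exact filterlim_atan_m_infty.
        + exact filterlim_atan_p_infty.
      - apply functional_extensionality. intros y.
        apply is_derive_unique, is_derive_atan_weight. }
    rewrite (Rmult_comm PI).
    apply (RInt_gen_norm (V := R_CompleteNormedModule) f (fun x => M * cauchy_weight x)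
       (line_integral f) (M * PI) line_le_ends).
    + apply filter_forall. intros ab x _. apply W.
    + eapply is_RInt_line; eauto.
    + apply (is_RInt_gen_scal (V := R_NormedModule) cauchy_weight M _ Hw).
  - intros F F' M N _ Hd W W'.
    destruct (cauchy_weight_vanishes M F (proj2 W)) as [L1 L2].
    assert (E : Derive F = F').
    { apply functional_extensionality. intros x. apply is_derive_unique, Hd. }
    rewrite <- (Rminus_diag 0), <- E.
    apply line_integral_unique.
    apply is_RInt_gen_Derive; trivial.
    + apply filter_forall. intros ab x _. eexists. apply Hd.
    + apply filter_forall. intros ab x _. rewrite E. apply W'.
Qed.

(** * The integral over a period *)

(** The integral over one period of a 1-periodic function. *)
Definition period_integral (f : R -> R) : R := RInt f 0 1.

Lemma period_integration : integration True (fun _ => 1) 1 period_integral.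
Proof.
  split.
  - intros; lra.
  - lra.
  - intros a b f g M N Wf Wg.
    apply (is_RInt_unique (V := R_CompleteNormedModule)).
    apply (is_RInt_plus (V := R_NormedModule) (fun x => a * f x) (fun x => b * g x)
       0 1 (a * period_integral f) (b * period_integral g)).
    + apply (is_RInt_scal (V := R_NormedModule) f 0 1 a).
      apply (RInt_correct (V := R_CompleteNormedModule)). eapply wbounded_ex_RInt; eauto.
    + apply (is_RInt_scal (V := R_NormedModule) g 0 1 b).
      apply (RInt_correct (V := R_CompleteNormedModule)). eapply wbounded_ex_RInt; eauto.
  - intros f M W. replace (1 * M) with ((1 - 0) * M) by ring.
    apply (norm_RInt_le_const (V := R_NormedModule) f 0 1 (period_integral f) M).
    + lra.
    + intros x _. rewrite <- (Rmult_1_r M). apply W.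
    + apply (RInt_correct (V := R_CompleteNormedModule)). eapply wbounded_ex_RInt; eauto.
  - intros F F' M N Hp Hd W W'.
    apply (is_RInt_unique (V := R_CompleteNormedModule)).
    replace 0 with (minus (F 1) (F 0)) at 2.
    + apply (is_RInt_derive (V := R_CompleteNormedModule)).
      * intros x _. apply Hd.
      * intros x _. apply W'.
    + rewrite <- (Rplus_0_l 1) at 1. rewrite (Hp I).
      unfold minus, plus, opp; simpl. ring.
Qed.

Lemma CRInt_cint h M phi : cwbounded h M phi -> CRInt phi 0 1 = cint period_integral phi.
Proof.
  intros [W1 W2]. apply (is_RInt_unique (V := C_R_CompleteNormedModule)).
  apply (is_RInt_fct_extend_pair (U := R_NormedModule) (V := R_NormedModule));
  apply (RInt_correct (V := R_CompleteNormedModule)); eapply wbounded_ex_RInt; eassumption.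
Qed.

Lemma CRInt_line_cint M phi : cwbounded cauchy_weight M phi ->
  CRInt_line phi = cint line_integral phi.
Proof.
  intros [W1 W2].
  refine (is_RInt_gen_unique (V := C_R_CompleteNormedModule)
    (Fa := Rbar_locally m_infty) (Fb := Rbar_locally p_infty)
    phi (cint line_integral phi) _).
  pose proof (is_RInt_line _ _ W1) as H1. pose proof (is_RInt_line _ _ W2) as H2.
  intros P [eps HP]. unfold filtermapi.
  pose proof (H1 _ (locally_ball _ eps)) as G1. unfold filtermapi in G1.
  pose proof (H2 _ (locally_ball _ eps)) as G2. unfold filtermapi in G2.
  generalize (filter_and _ _ G1 G2). apply filter_imp.
  intros ab [[y1 [A1 B1]] [y2 [A2 B2]]].
  exists (y1, y2). split.
  - now apply (is_RInt_fct_extend_pair (U := R_NormedModule) (V := R_NormedModule)).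
  - apply HP. now split.
Qed.

(** * Test functions and continuity of multipliers *)

Lemma Re_Im_le_Cmod (z : C) : Rabs (Re z) <= Cmod z /\ Rabs (Im z) <= Cmod z.
Proof.
  pose proof (Rmax_Cmod z) as H.
  pose proof (Rmax_l (Rabs (fst z)) (Rabs (snd z))).
  pose proof (Rmax_r (Rabs (fst z)) (Rabs (snd z))).
  unfold Re, Im. lra.
Qed.

(** The two seminorms with j = 0 and j = 2 give a bound by the weight. *)
Lemma cauchy_weight_intro (x M : R) (z : C) :
  Cmod (RtoC (x ^ 0) * z)%C <= M -> Cmod (RtoC (x ^ 2) * z)%C <= M ->
  Rabs (Re z) <= 2 * M * cauchy_weight x /\ Rabs (Im z) <= 2 * M * cauchy_weight x.
Proof.
  rewrite !Cmod_mult, !Cmod_R. rewrite (Rabs_pos_eq (x ^ 2)) by apply pow2_ge_0.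
  simpl (x ^ 0). rewrite Rabs_R1, Rmult_1_l. intros H0 H2.
  assert (H : Cmod z <= 2 * M * cauchy_weight x).
  { unfold cauchy_weight. pose proof (pow2_ge_0 x).
    apply (Rmult_le_reg_r (1 + x ^ 2)); [lra|].
    rewrite Rmult_assoc, Rinv_l, Rmult_1_r by lra. lra. }
  destruct (Re_Im_le_Cmod z). lra.
Qed.

Lemma schwartz_ctest phi : schwartz phi -> ctest False cauchy_weight phi.
Proof.
  intros [S1 S2].
  assert (B : forall k, exists M, forall x,
    Rabs (Re (CDerive_n phi k x)) <= M * cauchy_weight x /\
    Rabs (Im (CDerive_n phi k x)) <= M * cauchy_weight x).
  { intros k. destruct (S2 0%nat k) as [M0 H0], (S2 2%nat k) as [M2 H2].
    exists (2 * Rmax M0 M2). intros x. apply cauchy_weight_intro.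
    - eapply Rle_trans; [apply H0 | apply Rmax_l].
    - eapply Rle_trans; [apply H2 | apply Rmax_r]. }
  split; split; [| split | | split]; try easy.
  - intros k x. apply (S1 k x).
  - intros k. destruct (B k) as [M HM]. exists M. intros x. apply (HM x).
  - intros k x. apply (S1 k x).
  - intros k. destruct (B k) as [M HM]. exists M. intros x. apply (HM x).
Qed.

Lemma periodic_IZR (f : R -> R) : (forall x, f (x + 1) = f x) ->
  forall n x, f (x + IZR n) = f x.
Proof.
  intros Hp.
  assert (G : forall k x, f (x + INR k) = f x).
  { induction k as [|k IH]; intros x.
    - simpl. now rewrite Rplus_0_r.
    - rewrite S_INR, <- Rplus_assoc, Hp. apply IH. }
  intros n x. destruct (Z_le_gt_dec 0 n) as [H|H].
  - rewrite <- (Z2Nat.id n) by trivial. rewrite <- INR_IZR_INZ. apply G.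
  - rewrite <- (G (Z.to_nat (- n))). f_equal.
    rewrite INR_IZR_INZ, Z2Nat.id, opp_IZR by lia. ring.
Qed.

Lemma periodic_bounded (f : R -> R) : (forall x, f (x + 1) = f x) ->
  (forall x, continuous f x) -> exists M, forall x, Rabs (f x) <= M.
Proof.
  intros Hp Hc.
  destruct (continuity_ab_maj (fun x => Rabs (f x)) 0 1) as [m [Hm _]].
  - lra.
  - intros c _. apply continuity_pt_filterlim.
    apply (continuous_comp f Rabs); [apply Hc | apply continuous_Rabs].
  - exists (Rabs (f m)). intros x.
    replace x with (frac_part x + IZR (Int_part x)) by (unfold frac_part; ring).
    rewrite (periodic_IZR f Hp). apply Hm.
    destruct (base_fp x). lra.
Qed.

Lemma periodic_test_ctest phi : periodic_test phi ->
  ctest True (fun _ => 1) phi.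
Proof.
  intros [S1 S2].
  assert (G : forall f : R -> R, (forall k x, ex_derive_n f k x) ->
    (forall x, f (x + 1) = f x) -> rtest True (fun _ => 1) f).
  { intros f Hd Hp. split; [exact Hd|split; [|intros _; exact Hp]].
    intros k. destruct (periodic_bounded (Derive_n f k)) as [M HM].
    - intros x. rewrite <- Derive_n_comp_trans. apply Derive_n_ext. exact Hp.
    - intros x. apply (ex_derive_continuous (V := R_NormedModule)), (Hd (S k)).
    - exists M. intros x. rewrite Rmult_1_r. apply HM. }
  split; apply G; intros; try apply S1; now rewrite S2.
Qed.

Lemma ctest_continuous per h phi k x : ctest per h phi ->
  continuous (fun y => Re (CDerive_n phi k y)) x /\
  continuous (fun y => Im (CDerive_n phi k y)) x.
Proof.
  intros [T1 T2].
  destruct (rtest_wbounded _ k T1) as [M1 W1], (rtest_wbounded _ k T2) as [M2 W2].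
  split; [apply W1 | apply W2].
Qed.

Lemma schwartz_nbhd_cwbounded phi psi delta k : (k <= 2)%nat ->
  schwartz phi -> schwartz psi -> schwartz_nbhd psi 2 delta phi ->
  cwbounded cauchy_weight (2 * delta) (CDerive_n (fun x => phi x - psi x)%C k).
Proof.
  intros Hk S1 S2 Hn.
  pose proof (ctest_minus _ _ (schwartz_ctest _ S1) (schwartz_ctest _ S2)) as T.
  assert (B := fun x => cauchy_weight_intro x delta _ (Hn 0%nat k x ltac:(lia) Hk)
    (Hn 2%nat k x ltac:(lia) Hk)).
  split; split; intros x; try apply B; apply (ctest_continuous _ _ _ k x T).
Qed.

Lemma periodic_nbhd_cwbounded phi psi delta k : (k <= 2)%nat ->
  periodic_test phi -> periodic_test psi -> periodic_nbhd psi 2 delta phi ->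
  cwbounded (fun _ => 1) delta (CDerive_n (fun x => phi x - psi x)%C k).
Proof.
  intros Hk S1 S2 Hn.
  pose proof (ctest_minus _ _ (periodic_test_ctest _ S1) (periodic_test_ctest _ S2)) as T.
  split; split; intros x; try apply (ctest_continuous _ _ _ k x T);
  rewrite Rmult_1_r; (eapply Rle_trans; [apply Re_Im_le_Cmod | exact (Hn k x Hk)]).
Qed.

(** The choice of a radius for a functional with continuity constant [L]; the
    factor 2 is the one of [schwartz_nbhd_cwbounded]. *)
Lemma small_radius (L eps : R) : 0 < eps ->
  exists delta, 0 < delta /\ L * (2 * delta) < eps /\ L * delta < eps.
Proof.
  intros He. pose proof (Rabs_pos L). pose proof (Rle_abs L).
  assert (Hd : 0 < eps / (2 * (Rabs L + 1))) by (apply Rdiv_lt_0_compat; lra).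
  exists (eps / (2 * (Rabs L + 1))).
  assert (E : 2 * (Rabs L + 1) * (eps / (2 * (Rabs L + 1))) = eps) by (field; lra).
  set (d := eps / (2 * (Rabs L + 1))) in *.
  repeat split; trivial; nra.
Qed.

(** The identity with the multiplier is required for all weighted bounded
    functions, so that it applies to linear combinations of test functions
    without showing that these are test functions. *)
Lemma multiplier_tempered (T : (R -> C) -> C) c : cdominated (fun _ => 1) c ->
  (forall phi M, cwbounded cauchy_weight M phi -> T phi = multiplier line_integral c phi) ->
  tempered_distribution T.
Proof.
  intros Hc HT. split.
  - intros a b phi psi S1 S2.
    apply schwartz_ctest in S1. apply schwartz_ctest in S2.
    destruct (ctest_cwbounded line_integration _ S1) as [M [W1 _]],
      (ctest_cwbounded line_integration _ S2) as [N [W2 _]].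
    destruct (proj1 (cwbounded_lin line_integration a b _ _ _ _ W1 W2)) as [L W].
    rewrite (HT _ _ W), (HT _ _ W1), (HT _ _ W2).
    now apply (multiplier_lin line_integration).
  - intros psi S2 eps He.
    destruct (small_radius (16 * PI * SeriesZ (fun n => / (1 + IZR n ^ 2))) eps He)
      as [delta [Hd [Hb _]]].
    exists 2%nat, delta. split; trivial. intros phi S1 Hn.
    pose proof (schwartz_ctest _ S1) as T1. pose proof (schwartz_ctest _ S2) as T2.
    destruct (ctest_cwbounded line_integration _ T1) as [M [W1 _]],
      (ctest_cwbounded line_integration _ T2) as [N [W2 _]].
    rewrite (HT _ _ W1), (HT _ _ W2).
    eapply Rle_lt_trans; [|exact Hb].
    apply (multiplier_continuous line_integration); trivial.
    + now apply (schwartz_nbhd_cwbounded phi psi delta 0 ltac:(lia)).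
    + now apply (schwartz_nbhd_cwbounded phi psi delta 2 ltac:(lia)).
Qed.

Lemma multiplier_periodic (T : (R -> C) -> C) c : cdominated (fun _ => 1) c ->
  (forall phi M, cwbounded (fun _ => 1) M phi -> T phi = multiplier period_integral c phi) ->
  periodic_distribution T.
Proof.
  intros Hc HT. split.
  - intros a b phi psi S1 S2.
    apply periodic_test_ctest in S1. apply periodic_test_ctest in S2.
    destruct (ctest_cwbounded period_integration _ S1) as [M [W1 _]],
      (ctest_cwbounded period_integration _ S2) as [N [W2 _]].
    destruct (proj1 (cwbounded_lin period_integration a b _ _ _ _ W1 W2)) as [L W].
    rewrite (HT _ _ W), (HT _ _ W1), (HT _ _ W2).
    now apply (multiplier_lin period_integration).
  - intros psi S2 eps He.
    destruct (small_radius (16 * 1 * SeriesZ (fun n => / (1 + IZR n ^ 2))) eps He)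
      as [delta [Hd [_ Hb]]].
    exists 2%nat, delta. split; trivial. intros phi S1 Hn.
    pose proof (periodic_test_ctest _ S1) as T1. pose proof (periodic_test_ctest _ S2) as T2.
    destruct (ctest_cwbounded period_integration _ T1) as [M [W1 _]],
      (ctest_cwbounded period_integration _ T2) as [N [W2 _]].
    rewrite (HT _ _ W1), (HT _ _ W2).
    eapply Rle_lt_trans; [|exact Hb].
    apply (multiplier_continuous period_integration); trivial.
    + now apply (periodic_nbhd_cwbounded phi psi delta 0 ltac:(lia)).
    + now apply (periodic_nbhd_cwbounded phi psi delta 2 ltac:(lia)).
Qed.

(** * Fourier coefficients of a periodic multiplier functional *)

Lemma fourier_character_mult m n x :
  (fourier_character m x * fourier_character n x)%C = fourier_character (m + n) x.
Proof.
  rewrite !fourier_character_E, plus_IZR.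
  replace (2 * PI * (IZR m + IZR n) * x) with (2 * PI * IZR m * x + 2 * PI * IZR n * x) by ring.
  rewrite cos_plus, sin_plus.
  apply injective_projections; simpl; ring.
Qed.

Lemma wbounded_one a : wbounded (fun _ => 1) (Rabs a) (fun _ => a).
Proof.
  split; intros x; [apply continuous_const | lra].
Qed.

Lemma cwbounded_fourier_character n : cwbounded (fun _ => 1) 2 (fourier_character n).
Proof.
  replace (fourier_character n) with (fun x => RtoC 1 * fourier_character n x)%C
    by (apply functional_extensionality; intros; ring).
  replace 2 with (2 * 1) by ring. apply cwbounded_character.
  split; simpl; (eapply wbounded_le; [intros; lra | | apply wbounded_one]).
  - rewrite Rabs_R1; lra.
  - rewrite Rabs_R0; lra.
Qed.

(** Orthogonality of the characters: for n <> 0, integration by parts against the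
    constant function 1 shows that the n-th character has integral 0. *)
Lemma cint_fourier_character n :
  cint period_integral (fourier_character n) = if Z.eq_dec n 0 then RtoC 1 else RtoC 0.
Proof.
  destruct (Z.eq_dec n 0) as [-> | Hn].
  - unfold cint.
    replace (fun x => Re (fourier_character 0 x)) with (fun _ : R => 1).
    2: { apply functional_extensionality; intros x. rewrite fourier_character_E; simpl.
         rewrite Rmult_0_r, Rmult_0_l. symmetry; apply cos_0. }
    replace (fun x => Im (fourier_character 0 x)) with (fun _ : R => 0).
    2: { apply functional_extensionality; intros x. rewrite fourier_character_E; simpl.
         rewrite Rmult_0_r, Rmult_0_l. symmetry; apply sin_0. }
    rewrite (integration_zero period_integration).
    unfold period_integral. rewrite RInt_const.
    apply injective_projections; [|reflexivity].
    unfold scal; simpl; unfold mult; simpl; ring.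
  - destruct (cos_sin_coef_deriv period_integration (fun _ => 1) (fun _ => 0) _ _ n
      (fun _ _ => eq_refl) (fun x => is_derive_const 1 x) (wbounded_one 1) (wbounded_one 0))
      as [E1 E2].
    assert (Z1 : cos_coef period_integral (fun _ => 0) n = 0).
    { unfold cos_coef. replace (fun x => 0 * cos (2 * PI * IZR n * x)) with (fun _ : R => 0)
        by (apply functional_extensionality; intros; ring).
      apply (integration_zero period_integration). }
    assert (Z2 : sin_coef period_integral (fun _ => 0) n = 0).
    { unfold sin_coef. replace (fun x => 0 * sin (2 * PI * IZR n * x)) with (fun _ : R => 0)
        by (apply functional_extensionality; intros; ring).
      apply (integration_zero period_integration). }
    change (cos_coef period_integral (fun _ => 0) n
      = 2 * PI * IZR n * sin_coef period_integral (fun _ => 1) n) in E1.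
    change (sin_coef period_integral (fun _ => 0) n
      = - (2 * PI * IZR n * cos_coef period_integral (fun _ => 1) n)) in E2.
    rewrite Z1 in E1. rewrite Z2 in E2.
    assert (Ha : 2 * PI * IZR n <> 0).
    { pose proof PI_RGT_0. apply Rmult_integral_contrapositive. split; [lra|].
      now apply not_0_IZR. }
    assert (S1 : sin_coef period_integral (fun _ => 1) n = 0).
    { symmetry in E1. apply Rmult_integral in E1. tauto. }
    assert (C1 : cos_coef period_integral (fun _ => 1) n = 0).
    { symmetry in E2. apply Ropp_eq_0_compat in E2. rewrite Ropp_involutive in E2.
      apply Rmult_integral in E2. tauto. }
    unfold cint.
    replace (fun x => Re (fourier_character n x)) with (fun x => 1 * cos (2 * PI * IZR n * x)).
    2: { apply functional_extensionality; intros x. rewrite fourier_character_E; simpl; ring. }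
    replace (fun x => Im (fourier_character n x)) with (fun x => 1 * sin (2 * PI * IZR n * x)).
    2: { apply functional_extensionality; intros x. rewrite fourier_character_E; simpl; ring. }
    unfold cos_coef in C1. unfold sin_coef in S1. now rewrite C1, S1.
Qed.

Lemma multiplier_fourier_coef (T : (R -> C) -> C) c :
  (forall phi M, cwbounded (fun _ => 1) M phi -> T phi = multiplier period_integral c phi) ->
  forall n, fourier_coef T n = c (- n)%Z.
Proof.
  intros HT n. unfold fourier_coef.
  rewrite (HT _ _ (cwbounded_fourier_character (- n))). unfold multiplier.
  replace (fun m => c m * fourier_of period_integral (fourier_character (- n)) m)%C
    with (fun m => if Z.eq_dec m (- n) then c (- n)%Z else RtoC 0).
  - apply injective_projections; simpl.
    + rewrite <- (SeriesZ_single (- n) (fst (c (- n)%Z))). f_equal.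
      apply functional_extensionality; intros m. now destruct Z.eq_dec.
    + rewrite <- (SeriesZ_single (- n) (snd (c (- n)%Z))). f_equal.
      apply functional_extensionality; intros m. now destruct Z.eq_dec.
  - apply functional_extensionality; intros m. rewrite fourier_of_eq.
    replace (fun x => fourier_character (- n) x * fourier_character (- m) x)%C
      with (fourier_character (- n + - m))
      by (apply functional_extensionality; intros; now rewrite fourier_character_mult).
    rewrite cint_fourier_character.
    destruct (Z.eq_dec m (- n)) as [H|H], (Z.eq_dec (- n + - m) 0) as [H'|H'];
      try lia; [rewrite H|]; ring.
Qed.

(** * The coefficients of the two series *)

(** The exponent 2 pi i r^2 sqrt(1-(n/r)^2) zeta, with the branch of the square root
    of [csqrt]. *)
Definition propagator_exponent (r zeta : R) (n : Z) : C :=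
  (2 * PI * Ci * (r ^ 2)%R * csqrt (1 - (IZR n / r) ^ 2)%R * zeta)%C.

(** The n-th Fourier coefficient of w_r(., zeta), for positive r and zeta. *)
Definition w_symbol (r zeta : R) (n : Z) : C :=
  (Cexp (- (2 * PI * Ci * (r ^ 2)%R * zeta)) * Cexp (propagator_exponent r zeta n))%C.

(** The n-th Fourier coefficient of v(., zeta). *)
Definition v_symbol (zeta : R) (n : Z) : C :=
  Cexp (- (Ci * PI * (IZR n ^ 2)%R * zeta))%C.

Lemma Cexp_plus (a b : C) : Cexp (a + b)%C = (Cexp a * Cexp b)%C.
Proof.
  destruct a as [a1 a2], b as [b1 b2]. unfold Cexp. simpl.
  rewrite exp_plus, cos_plus, sin_plus.
  apply injective_projections; simpl; ring.
Qed.

Lemma Cexp_dom (z : C) x : exp (Re z) <= x ->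
  Rabs (Re (Cexp z)) <= x /\ Rabs (Im (Cexp z)) <= x.
Proof.
  intros Hx. pose proof (exp_pos (Re z)).
  unfold Cexp. simpl. rewrite !Rabs_mult, (Rabs_pos_eq (exp (Re z))) by lra.
  split; (eapply Rle_trans; [|exact Hx]); rewrite <- (Rmult_1_r (exp (Re z))) at 2;
  (apply Rmult_le_compat_l; [lra|]); apply Rabs_le; [apply COS_bound | apply SIN_bound].
Qed.

Lemma v_symbol_E zeta n :
  v_symbol zeta n = (cos (- (PI * IZR n ^ 2 * zeta)), sin (- (PI * IZR n ^ 2 * zeta))).
Proof.
  apply Cexp_imag. apply injective_projections; simpl; ring.
Qed.

Lemma v_symbol_dom zeta : cdominated (fun _ => 1) (v_symbol zeta).
Proof.
  intros n. rewrite v_symbol_E; simpl.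
  split; apply Rabs_le; [apply COS_bound | apply SIN_bound].
Qed.

(** For |n| <= r the square root on the right has a nonpositive argument and takes
    the value 0. *)
Lemma Re_propagator_exponent r zeta n : r <> 0 ->
  Re (propagator_exponent r zeta n) =
    - (2 * PI * r ^ 2 * zeta * sqrt ((IZR n / r) ^ 2 - 1)).
Proof.
  intros Hr. unfold propagator_exponent, csqrt.
  destruct Rle_dec as [H|H].
  - rewrite (sqrt_neg_0 ((IZR n / r) ^ 2 - 1)) by lra. simpl. ring.
  - replace (- (1 - (IZR n / r) ^ 2)) with ((IZR n / r) ^ 2 - 1) by ring.
    simpl. ring.
Qed.

Lemma exp_nonpos_le_1 x : x <= 0 -> exp x <= 1.
Proof.
  rewrite <- exp_0. intros [H | ->]; [now apply Rlt_le, exp_increasing | apply Rle_refl].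
Qed.

Lemma exp_neg_le_inv_sqr t : 0 < t -> exp (- t) <= 4 / t ^ 2.
Proof.
  intros Ht. rewrite exp_Ropp.
  pose proof (exp_ineq1_le (t / 2)) as H.
  assert (E : exp t = exp (t / 2) * exp (t / 2)) by (rewrite <- exp_plus; f_equal; lra).
  replace (4 / t ^ 2) with (/ ((t / 2) * (t / 2))) by (field; lra).
  apply Rinv_le_contravar; nra.
Qed.

Lemma decay_rate_pos r zeta : 0 < r -> 0 < zeta -> 0 < 2 * PI * r ^ 2 * zeta.
Proof.
  intros Hr Hz. pose proof PI_RGT_0. pose proof (pow_lt r 2 Hr).
  apply Rmult_lt_0_compat; trivial. apply Rmult_lt_0_compat; lra.
Qed.

(** If n^2 <= 2 r^2 then 1 <= (1 + 2 r^2) / (1 + n^2). Otherwise n^2 - r^2 >= n^2 / 2,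
    and the exponential e^{-t} is at most 4 / t^2, of order 1 / n^2. *)
Lemma exp_propagator_decay r zeta n : 0 < r -> 0 < zeta ->
  exp (Re (propagator_exponent r zeta n)) <=
    (1 + 2 * r ^ 2 + 2 / (r ^ 2 * zeta ^ 2)) * / (1 + IZR n ^ 2).
Proof.
  intros Hr Hz. rewrite Re_propagator_exponent by lra.
  pose proof PI2_1. assert (Hp : 1 < PI) by lra.
  assert (Hr2 : 0 < r ^ 2) by (apply pow_lt; trivial).
  assert (Hz2 : 0 < zeta ^ 2) by (apply pow_lt; trivial).
  assert (Hrz : 0 < r ^ 2 * zeta ^ 2) by (apply Rmult_lt_0_compat; trivial).
  assert (Hq : 0 < 2 / (r ^ 2 * zeta ^ 2)) by (apply Rdiv_lt_0_compat; lra).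
  pose proof (pow2_ge_0 (IZR n)) as Hn.
  set (m := IZR n ^ 2) in *.
  assert (Em : (IZR n / r) ^ 2 = m / r ^ 2) by (unfold m; field; lra).
  rewrite Em.
  apply (Rmult_le_reg_r (1 + m)); [lra|].
  rewrite (Rmult_assoc _ (/ (1 + m)) (1 + m)), Rinv_l, Rmult_1_r by lra.
  destruct (Rle_dec m (2 * r ^ 2)) as [H1|H1].
  - assert (exp (- (2 * PI * r ^ 2 * zeta * sqrt (m / r ^ 2 - 1))) <= 1).
    { apply exp_nonpos_le_1.
      pose proof (sqrt_pos (m / r ^ 2 - 1)).
      assert (0 <= 2 * PI * r ^ 2 * zeta * sqrt (m / r ^ 2 - 1)); [|lra].
      apply Rmult_le_pos; [now apply Rlt_le, decay_rate_pos | trivial]. }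
    apply Rle_trans with (1 * (1 + m)); [apply Rmult_le_compat_r; lra | lra].
  - apply Rnot_le_lt in H1.
    assert (Hm1 : 1 <= m).
    { unfold m. assert (n <> 0%Z) by (intros E; assert (m = 0) by (unfold m; rewrite E; ring); lra).
      replace (IZR n ^ 2) with (IZR (n * n)) by (rewrite mult_IZR; ring).
      apply IZR_le. nia. }
    assert (Hs0 : m / r ^ 2 / 2 <= m / r ^ 2 - 1).
    { apply (Rmult_le_reg_r (2 * r ^ 2)); [lra|].
      replace (m / r ^ 2 / 2 * (2 * r ^ 2)) with m by (field; lra).
      replace ((m / r ^ 2 - 1) * (2 * r ^ 2)) with (2 * m - 2 * r ^ 2) by (field; lra).
      lra. }
    assert (Hs1 : 0 < m / r ^ 2) by (apply Rdiv_lt_0_compat; lra).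
    set (t := 2 * PI * r ^ 2 * zeta * sqrt (m / r ^ 2 - 1)).
    assert (Ht : 0 < t).
    { unfold t. apply Rmult_lt_0_compat; [now apply decay_rate_pos | apply sqrt_lt_R0; lra]. }
    assert (Ht2 : 2 * (r ^ 2 * zeta ^ 2) * m <= t ^ 2).
    { unfold t. rewrite !Rpow_mult_distr, pow2_sqrt by lra.
      replace (2 * (r ^ 2 * zeta ^ 2) * m) with
        (2 ^ 2 * 1 ^ 2 * (r ^ 2) ^ 2 * zeta ^ 2 * (m / r ^ 2 / 2)) by (field; lra).
      apply Rmult_le_compat; trivial; try lra.
      - repeat apply Rmult_le_pos; try lra; apply pow2_ge_0.
      - repeat (apply Rmult_le_compat_r; [apply pow2_ge_0|]).
        apply Rmult_le_compat_l; [apply pow2_ge_0|]. apply pow_incr. lra. }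
    pose proof (exp_neg_le_inv_sqr t Ht) as He.
    assert (H4 : 4 / t ^ 2 <= 2 / (r ^ 2 * zeta ^ 2) * / m).
    { replace (2 / (r ^ 2 * zeta ^ 2) * / m) with (4 / (2 * (r ^ 2 * zeta ^ 2) * m)) by (field; lra).
      unfold Rdiv. apply Rmult_le_compat_l; [lra|]. apply Rinv_le_contravar; trivial.
      apply Rmult_lt_0_compat; lra. }
    assert (H5 : exp (- t) <= 1) by (apply exp_nonpos_le_1; lra).
    assert (H6 : exp (- t) * m <= 2 / (r ^ 2 * zeta ^ 2)).
    { apply (Rmult_le_reg_r (/ m)); [apply Rinv_0_lt_compat; lra|].
      rewrite Rmult_assoc, Rinv_r, Rmult_1_r by lra. lra. }
    lra.
Qed.

Lemma exp_propagator_le_1 r zeta n : 0 < r -> 0 < zeta ->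
  exp (Re (propagator_exponent r zeta n)) <= 1.
Proof.
  intros Hr Hz. rewrite Re_propagator_exponent by lra.
  apply exp_nonpos_le_1.
  pose proof (sqrt_pos ((IZR n / r) ^ 2 - 1)).
  assert (0 <= 2 * PI * r ^ 2 * zeta * sqrt ((IZR n / r) ^ 2 - 1)); [|lra].
  apply Rmult_le_pos; [now apply Rlt_le, decay_rate_pos | trivial].
Qed.

Lemma w_symbol_dom_gen r zeta n x : exp (Re (propagator_exponent r zeta n)) <= x ->
  Rabs (Re (w_symbol r zeta n)) <= x /\ Rabs (Im (w_symbol r zeta n)) <= x.
Proof.
  intros H. unfold w_symbol. rewrite <- Cexp_plus. apply Cexp_dom.
  replace (Re (- (2 * PI * Ci * (r ^ 2)%R * zeta) + propagator_exponent r zeta n)%C)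
    with (Re (propagator_exponent r zeta n)); trivial.
  unfold Re; simpl. ring.
Qed.

Lemma w_symbol_dom r zeta : 0 < r -> 0 < zeta -> cdominated (fun _ => 1) (w_symbol r zeta).
Proof. intros Hr Hz n. apply w_symbol_dom_gen. now apply exp_propagator_le_1. Qed.

Lemma w_symbol_even r zeta n : w_symbol r zeta (- n) = w_symbol r zeta n.
Proof.
  unfold w_symbol, propagator_exponent. rewrite opp_IZR.
  do 4 f_equal. f_equal. f_equal. unfold Rdiv. ring.
Qed.

Lemma w_symbol_cvg zeta n :
  filterlim (fun r => Re (w_symbol r zeta n)) (Rbar_locally p_infty)
    (locally (Re (v_symbol zeta n))) /\
  filterlim (fun r => Im (w_symbol r zeta n)) (Rbar_locally p_infty)
    (locally (Im (v_symbol zeta n))).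
Proof.
  (* For r > |n|, [g] is the phase of the symbol as a function of 1/r. The form
     without cancellation makes it continuous at 0. *)
  set (g := fun u => - (2 * PI * IZR n ^ 2 * zeta / (1 + sqrt (1 - (IZR n * u) ^ 2)))).
  assert (Hg : filterlim (fun r => g (/ r)) (Rbar_locally p_infty)
    (locally (- (PI * IZR n ^ 2 * zeta)))).
  { replace (- (PI * IZR n ^ 2 * zeta)) with (g 0).
    2: { unfold g. replace (1 - (IZR n * 0) ^ 2) with 1 by ring.
         rewrite sqrt_1. field. }
    apply filterlim_comp with (locally 0).
    - apply filterlim_locally. intros eps. exists (/ eps). intros r Hr.
      pose proof (cond_pos eps) as He.
      assert (H0 : 0 < / eps) by now apply Rinv_0_lt_compat.
      change (Rabs (/ r - 0) < eps). rewrite Rminus_0_r, Rabs_pos_eq.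
      + rewrite <- (Rinv_inv eps). apply Rinv_lt_contravar; [nra|trivial].
      + apply Rlt_le, Rinv_0_lt_compat; lra.
    - apply (ex_derive_continuous (V := R_NormedModule) g 0). unfold g.
      auto_derive. replace (1 + - (IZR n * 0) ^ 2) with 1 by ring.
      rewrite ?Rmult_0_r. rewrite ?sqrt_1. repeat split; try lra.
      all: replace (1 + - (0 * (0 * 1))) with 1 by ring; rewrite ?sqrt_1; lra. }
  assert (E : forall r, Rabs (IZR n) < r ->
    (cos (g (/ r)), sin (g (/ r))) = w_symbol r zeta n).
  { intros r Hr. pose proof (Rabs_pos (IZR n)).
    assert (Hx : 0 <= 1 - (IZR n / r) ^ 2).
    { rewrite <- pow2_abs. unfold Rdiv. rewrite Rabs_mult, (Rabs_pos_eq (/ r))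
        by (apply Rlt_le, Rinv_0_lt_compat; lra).
      assert (0 <= Rabs (IZR n) * / r <= 1).
      { split; [apply Rmult_le_pos; [lra|apply Rlt_le, Rinv_0_lt_compat; lra]|].
        apply (Rmult_le_reg_r r); [lra|]. rewrite Rmult_assoc, Rinv_l; lra. }
      nra. }
    unfold w_symbol. rewrite <- Cexp_plus. symmetry. apply Cexp_imag.
    unfold propagator_exponent, csqrt. destruct Rle_dec as [_|H']; [|contradiction].
    unfold g. change (IZR n * / r) with (IZR n / r).
    set (y := 1 - (IZR n / r) ^ 2) in *.
    pose proof (sqrt_pos y) as Hy.
    assert (Ey : IZR n ^ 2 = r ^ 2 * (1 - sqrt y) * (1 + sqrt y)).
    { replace (r ^ 2 * (1 - sqrt y) * (1 + sqrt y)) with (r ^ 2 * (1 - sqrt y ^ 2)) by ring.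
      rewrite pow2_sqrt by trivial. unfold y. field. lra. }
    rewrite Ey.
    apply injective_projections; simpl; field; lra. }
  rewrite v_symbol_E. unfold Re, Im. cbn [fst snd].
  split.
  - apply filterlim_ext_loc with (fun r => cos (g (/ r))).
    { exists (Rabs (IZR n)). intros r Hr. now rewrite <- E. }
    eapply filterlim_comp; [exact Hg|]. apply continuous_cos.
  - apply filterlim_ext_loc with (fun r => sin (g (/ r))).
    { exists (Rabs (IZR n)). intros r Hr. now rewrite <- E. }
    eapply filterlim_comp; [exact Hg|]. apply continuous_sin.
Qed.

Lemma w_fourier_series r xi zeta : 0 < r -> 0 < zeta ->
  w r xi zeta = CSeriesZ (fun n => w_symbol r zeta n * fourier_character n xi)%C.
Proof.
  intros Hr Hz. unfold w. destruct (Rle_dec 0 zeta) as [_|H]; [|lra].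
  set (A := Cexp (- (2 * PI * Ci * (r ^ 2)%R * zeta))%C).
  set (b := fun n => 2 * (1 + 2 * r ^ 2 + 2 / (r ^ 2 * zeta ^ 2)) * / (1 + IZR n ^ 2)).
  assert (Hd : cdominated b
    (fun n => Cexp (propagator_exponent r zeta n) * fourier_character n xi)%C).
  { intros n. unfold b. rewrite Rmult_assoc, (Rmult_comm 2), Rmult_assoc, (Rmult_comm _ 2).
    rewrite <- Rmult_assoc, (Rmult_comm _ 2), Rmult_assoc.
    rewrite <- (Rmult_1_r (2 * _)).
    apply Cmult_dom; [apply Cexp_dom; now apply exp_propagator_decay|].
    rewrite fourier_character_E; simpl.
    split; apply Rabs_le; [apply COS_bound | apply SIN_bound]. }
  assert (Hb : ex_seriesZ b) by apply ex_seriesZ_scal, ex_seriesZ_inv_sqr.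
  transitivity (A * CSeriesZ (fun n => Cexp (propagator_exponent r zeta n) * fourier_character n xi)
    + 0 * CSeriesZ (fun n => Cexp (propagator_exponent r zeta n) * fourier_character n xi))%C.
  - unfold w_nonneg. fold A. rewrite Cmult_0_l, Cplus_0_r. reflexivity.
  - rewrite <- (CSeriesZ_lin _ _ _ _ _ _ Hd Hd Hb Hb). f_equal.
    apply functional_extensionality; intros n. unfold w_symbol. fold A. ring.
Qed.

(** * The two functionals as multipliers *)

Section Functionals.

Context {per : Prop} {h : R -> R} {K : R} {J : (R -> R) -> R}.
Context (HJ : integration per h K J).
Context {I : (R -> C) -> C}.
Context (HI : forall M phi, cwbounded h M phi -> I phi = cint J phi).

Lemma w_functional r zeta phi M : 0 < r -> 0 < zeta -> cwbounded h M phi ->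
  I (fun xi => w r xi zeta * phi xi)%C = multiplier J (w_symbol r zeta) phi.
Proof.
  intros Hr Hz W.
  replace (fun xi => w r xi zeta * phi xi)%C with
    (fun xi => CSeriesZ (fun n => w_symbol r zeta n * fourier_character n xi) * phi xi)%C
    by (apply functional_extensionality; intros xi; now rewrite <- w_fourier_series).
  set (b := fun n => (1 + 2 * r ^ 2 + 2 / (r ^ 2 * zeta ^ 2)) * / (1 + IZR n ^ 2)).
  assert (Hd : cdominated b (w_symbol r zeta)).
  { intros n. apply w_symbol_dom_gen. now apply exp_propagator_decay. }
  assert (Hb : ex_seriesZ b) by apply ex_seriesZ_scal, ex_seriesZ_inv_sqr.
  destruct (proj1 (cint_fourier_series HJ _ _ _ _ Hd Hb W)) as [L WL].
  rewrite (HI _ _ WL).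
  apply (cint_even_fourier_series HJ _ b _ M); trivial. apply w_symbol_even.
Qed.

Lemma v_functional (zeta : R) phi M : cwbounded h M phi ->
  CSeriesZ (fun n => Cexp (- (Ci * PI * (IZR n ^ 2)%R * zeta)) *
    I (fun xi : R => phi xi * Cexp (- (2 * PI * Ci * IZR n * xi))))%C =
  multiplier J (v_symbol zeta) phi.
Proof.
  intros W. unfold multiplier. f_equal. apply functional_extensionality; intros n.
  unfold v_symbol. f_equal. rewrite fourier_of_eq.
  rewrite <- (HI _ _ (cwbounded_character _ _ _ W)). f_equal.
  apply functional_extensionality; intros x. now rewrite fourier_kernel_E.
Qed.

End Functionals.

(** * Convergence *)

Lemma w_cvg_tempered zeta : 0 < zeta ->
  cvg_tempered (fun r => fun_tempered (fun xi => w r xi zeta)) (v_tempered zeta).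
Proof.
  intros Hz.
  assert (Hw : forall r, 0 < r -> forall phi M, cwbounded cauchy_weight M phi ->
    fun_tempered (fun xi => w r xi zeta) phi = multiplier line_integral (w_symbol r zeta) phi).
  { intros r Hr phi M W. exact (w_functional line_integration CRInt_line_cint r zeta phi M Hr Hz W). }
  assert (Hv : forall phi M, cwbounded cauchy_weight M phi ->
    v_tempered zeta phi = multiplier line_integral (v_symbol zeta) phi).
  { intros phi M W. exact (v_functional CRInt_line_cint zeta phi M W). }
  split; [|split].
  - intros r Hr. apply (multiplier_tempered _ (w_symbol r zeta)); [now apply w_symbol_dom|].
    now apply Hw.
  - apply (multiplier_tempered _ (v_symbol zeta)); trivial. apply v_symbol_dom.
  - intros phi S. apply schwartz_ctest in S.
    destruct (ctest_cwbounded line_integration _ S) as [M [W _]].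
    rewrite (Hv _ _ W).
    apply filterlim_ext_loc with (fun r => multiplier line_integral (w_symbol r zeta) phi).
    { exists 0. intros r Hr. symmetry. now apply (Hw r Hr phi M). }
    refine (multiplier_cvg line_integration (Rbar_locally p_infty) _ _ _ _ _ _ _ S).
    + exists 0. intros r Hr. now apply w_symbol_dom.
    + apply v_symbol_dom.
    + intros n. apply w_symbol_cvg.
    + intros n. apply w_symbol_cvg.
Qed.

Lemma Cmod_sqr (z : C) : Cmod z ^ 2 = Re z ^ 2 + Im z ^ 2.
Proof.
  unfold Cmod. rewrite pow2_sqrt; [reflexivity|].
  pose proof (pow2_ge_0 (fst z)). pose proof (pow2_ge_0 (snd z)). lra.
Qed.

Lemma Cmod_sqr_dom (z : C) (x : R) : Rabs (Re z) <= x /\ Rabs (Im z) <= x ->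
  0 <= Cmod z ^ 2 <= 2 * x ^ 2.
Proof.
  intros [H1 H2]. split; [apply pow2_ge_0|].
  rewrite Cmod_sqr, <- (pow2_abs (Re z)), <- (pow2_abs (Im z)).
  pose proof (pow_incr _ _ 2 (conj (Rabs_pos (Re z)) H1)).
  pose proof (pow_incr _ _ 2 (conj (Rabs_pos (Im z)) H2)). lra.
Qed.

Lemma multiplier_in_sobolev s (T : (R -> C) -> C) c : 1 / 2 < s -> cdominated (fun _ => 1) c ->
  (forall phi M, cwbounded (fun _ => 1) M phi -> T phi = multiplier period_integral c phi) ->
  in_sobolev (- s) T.
Proof.
  intros Hs Hc HT. split; [now apply (multiplier_periodic _ c)|].
  apply (ex_seriesZ_Rabs_le _ (fun n => 2 * Rpower (1 + IZR n ^ 2) (- s))).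
  - intros n. unfold sobolev_term. rewrite (multiplier_fourier_coef _ _ HT).
    destruct (Cmod_sqr_dom (c (- n)%Z) 1 (Hc _)).
    pose proof (exp_pos (- s * ln (1 + IZR n ^ 2))).
    fold (Rpower (1 + IZR n ^ 2) (- s)) in *.
    rewrite Rabs_pos_eq by (apply Rmult_le_pos; lra). nra.
  - now apply ex_seriesZ_scal, ex_seriesZ_Sobolev_weight.
Qed.

Lemma w_cvg_sobolev zeta s : 0 < zeta -> 1 / 2 < s ->
  cvg_sobolev (- s) (fun r => fun_periodic (fun xi => w r xi zeta)) (v_periodic zeta).
Proof.
  intros Hz Hs.
  assert (Hw : forall r, 0 < r -> forall phi M, cwbounded (fun _ => 1) M phi ->
    fun_periodic (fun xi => w r xi zeta) phi = multiplier period_integral (w_symbol r zeta) phi).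
  { intros r Hr phi M W.
    exact (w_functional period_integration (CRInt_cint _) r zeta phi M Hr Hz W). }
  assert (Hv : forall phi M, cwbounded (fun _ => 1) M phi ->
    v_periodic zeta phi = multiplier period_integral (v_symbol zeta) phi).
  { intros phi M W. exact (v_functional (CRInt_cint _) zeta phi M W). }
  split; [|split].
  - intros r Hr. apply (multiplier_in_sobolev _ _ (w_symbol r zeta)); trivial;
    [now apply w_symbol_dom | now apply Hw].
  - apply (multiplier_in_sobolev _ _ (v_symbol zeta)); trivial. apply v_symbol_dom.
  - set (d := fun r n => Rpower (1 + IZR n ^ 2) (- s) *
      Cmod (w_symbol r zeta (- n) - v_symbol zeta (- n))%C ^ 2).
    assert (Hd : filterlim (fun r => SeriesZ (d r)) (Rbar_locally p_infty)
      (locally (SeriesZ (fun _ => 0)))).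
    { apply (filterlim_SeriesZ_dominated _ d (fun _ => 0)
        (fun n => 8 * Rpower (1 + IZR n ^ 2) (- s))).
      - now apply ex_seriesZ_scal, ex_seriesZ_Sobolev_weight.
      - exists 0. intros r Hr n. unfold d.
        destruct (w_symbol_dom r zeta Hr Hz (- n)%Z) as [A1 A2].
        destruct (v_symbol_dom zeta (- n)%Z) as [B1 B2].
        destruct (Cmod_sqr_dom (w_symbol r zeta (- n) - v_symbol zeta (- n))%C 2) as [C1 C2].
        { revert A1 A2 B1 B2. destruct (w_symbol r zeta (- n)) as [a1 a2].
          destruct (v_symbol zeta (- n)) as [b1 b2]. simpl.
          split; split_Rabs; lra. }
        pose proof (exp_pos (- s * ln (1 + IZR n ^ 2))).
        fold (Rpower (1 + IZR n ^ 2) (- s)) in *.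
        rewrite Rabs_pos_eq by (apply Rmult_le_pos; lra). nra.
      - intros n. rewrite Rabs_R0. apply Rmult_le_pos; [lra|]. apply Rlt_le, exp_pos.
      - intros n. unfold d. destruct (w_symbol_cvg zeta (- n)) as [L1 L2].
        set (p := Rpower (1 + IZR n ^ 2) (- s)).
        set (x := Re (v_symbol zeta (- n))) in *. set (y := Im (v_symbol zeta (- n))) in *.
        apply filterlim_ext with (fun r => p * (Re (w_symbol r zeta (- n)) - x) ^ 2
          + p * (Im (w_symbol r zeta (- n)) - y) ^ 2).
        { intros r. rewrite Cmod_sqr. unfold x, y, Re, Im; simpl. ring. }
        assert (G : forall (u : R -> R) (z : R), filterlim u (Rbar_locally p_infty) (locally z) ->
          filterlim (fun r => p * (u r - z) ^ 2) (Rbar_locally p_infty) (locally 0)).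
        { intros u z Hu. replace 0 with (p * (z - z) ^ 2) at 1 by ring.
          apply (filterlim_comp _ _ _ u (fun t => p * (t - z) ^ 2) _ _ _ Hu).
          apply (ex_derive_continuous (V := R_NormedModule) (fun t => p * (t - z) ^ 2) z).
          auto_derive; trivial. }
        rewrite <- (Rplus_0_l 0) at 1.
        eapply filterlim_comp_2; [exact (G _ _ L1) | exact (G _ _ L2) |].
        apply (filterlim_plus (V := R_NormedModule)). }
    unfold SeriesZ at 2 in Hd. rewrite Series_zero, Rplus_0_l in Hd.
    apply filterlim_ext_loc with (fun r => sqrt (SeriesZ (d r))).
    { exists 0. intros r Hr. unfold sobolev_norm. do 2 f_equal.
      apply functional_extensionality; intros n. unfold sobolev_term, d. do 3 f_equal.
      pose proof (multiplier_fourier_coef _ _ (Hw r Hr) n) as E1.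
      pose proof (multiplier_fourier_coef _ _ Hv n) as E2.
      unfold fourier_coef in *. now rewrite E1, E2. }
    rewrite <- sqrt_0.
    eapply filterlim_comp; [exact Hd|]. apply continuous_sqrt.
Qed.

Lemma w_abs r xi zeta : w r xi zeta = w r xi (Rabs zeta).
Proof.
  unfold w. destruct (Rle_dec 0 (Rabs zeta)) as [_|H].
  - destruct (Rle_dec 0 zeta); [now rewrite Rabs_pos_eq | reflexivity].
  - elim H. apply Rabs_pos.
Qed.

Theorem theorem1 : forall zeta : R,
  (0 < zeta ->
    cvg_tempered (fun r => fun_tempered (fun xi => w r xi zeta))
      (v_tempered zeta) /\
    (forall s : R, 1 / 2 < s ->
      cvg_sobolev (- s) (fun r => fun_periodic (fun xi => w r xi zeta))
        (v_periodic zeta)))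
  /\
  (zeta < 0 ->
    (forall r xi : R, 0 < r -> w r xi zeta = w r xi (Rabs zeta)) /\
    cvg_tempered (fun r => fun_tempered (fun xi => w r xi zeta))
      (v_tempered (Rabs zeta)) /\
    (forall s : R, 1 / 2 < s ->
      cvg_sobolev (- s) (fun r => fun_periodic (fun xi => w r xi zeta))
        (v_periodic (Rabs zeta)))).
Proof.
  intros zeta. split.
  - intros Hz. split; [now apply w_cvg_tempered|].
    intros s Hs. now apply w_cvg_sobolev.
  - intros Hz.
    assert (Ha : 0 < Rabs zeta) by (apply Rabs_pos_lt; lra).
    assert (E : (fun r xi => w r xi zeta) = (fun r xi => w r xi (Rabs zeta))).
    { apply functional_extensionality; intros r. apply functional_extensionality; intros xi.
      apply w_abs. }
    split; [intros; apply w_abs|].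
    change (fun r => fun_tempered (fun xi => w r xi zeta)) with
      (fun r => fun_tempered ((fun r xi => w r xi zeta) r)).
    change (fun r => fun_periodic (fun xi => w r xi zeta)) with
      (fun r => fun_periodic ((fun r xi => w r xi zeta) r)).
    rewrite E. split; [now apply w_cvg_tempered|].
    intros s Hs. now apply w_cvg_sobolev.
Qed.
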